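(* There is an algorithm which, given a bipartite graph $G=(V_1\cup V_2,E)$ with $|V_1|=|V_2|=n$ and average degree $\Delta\ge 3$ (i.e. $|E|=\Delta n$), computes the number of perfect matchings of $G$ in time $O^{\ast}\!\left(2^{\left(1-\frac{1}{5\Delta\log\Delta}\right)n}\right)$, using exponential space.
   Context: A perfect matching of a graph is a set of edges such that every vertex is incident to exactly one of them. $O^{\ast}(f(n))$ denotes $O(f(n)\cdot\mathrm{poly}(n))$, i.e. big-O with polynomial factors in $n$ suppressed. The average degree of a graph with vertex set $V$ and edge set $E$ is $2|E|/|V|$. *)

(* Defs.v *)
From HB Require Import structures.
From mathcomp Require Import all_boot all_order all_algebra.
From mathcomp Require Import reals exp.

Set Implicit Arguments.
Unset Strict Implicit.
Unset Printing Implicit Defensive.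

Import Order.TTheory GRing.Theory Num.Theory.

(** Bipartite graphs with V1 = V2 = {0, ..., n-1} (as disjoint copies).  The
    pair (i, j) is the edge joining i in V1 to j in V2. *)

Definition vertex (n : nat) := ('I_n + 'I_n)%type.

Definition bigraph (n : nat) := {set 'I_n * 'I_n}.

Definition incident n (v : vertex n) (e : 'I_n * 'I_n) : bool :=
  match v with inl i => e.1 == i | inr j => e.2 == j end.

Definition perfect_matching n (E M : bigraph n) : bool :=
  (M \subset E) && [forall v : vertex n, #|[set e in M | incident v e]| == 1].

Definition perfect_matchings n (E : bigraph n) : {set bigraph n} :=
  [set M | perfect_matching E M].

Definition avg_degree (R : realType) n (E : bigraph n) : R :=
  (2 * #|E|%:R / #|{: vertex n}|%:R)%R.

Definition log2 (R : realType) (x : R) : R := (ln x / ln 2)%R.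

(** Random access machines over nat under the logarithmic cost criterion,
    presented as structured programs.  A location is a register [inl r], named
    statically in the program, or a memory cell [inr a], whose address may be
    computed at run time. *)

Definition loc := (nat + nat)%type.

Definition state := loc -> nat.

Definition upd (s : state) (l : loc) (v : nat) : state :=
  fun l' => if l' == l then v else s l'.

Inductive binop := Add | Sub | Mul | Div.

Inductive expr :=
  | Cst of nat
  | Reg of nat
  | Mem of expr
  | Op of binop & expr & expr.

Inductive cmd :=
  | Skip
  | SetReg of nat & expr
  | SetMem of expr & expr
  | Seq of cmd & cmd
  | If of expr & cmd & cmd
  | While of expr & cmd.

(* Number of binary digits, with [bitlen 0 = 1]. *)
Definition bitlen (n : nat) : nat := (trunc_log 2 n).+1.

Definition loc_len (l : loc) : nat :=
  match l with inl r => bitlen r | inr a => bitlen a end.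

Definition access_cost (l : loc) (v : nat) : nat := loc_len l + bitlen v.

(* [Sub] is truncated at 0, and [Div] by 0 returns 0. *)
Definition binop_eval (o : binop) (a b : nat) : nat :=
  match o with
  | Add => a + b
  | Sub => a - b
  | Mul => a * b
  | Div => a %/ b
  end.

(* Multiplication and division are charged the schoolbook bit cost, so that no
   super-polynomial speed-up can be hidden in arithmetic on long numbers. *)
Definition binop_cost (o : binop) (a b : nat) : nat :=
  match o with
  | Add | Sub => bitlen a + bitlen b
  | Mul | Div => bitlen a * bitlen b
  end.

Fixpoint eval (s : state) (e : expr) : nat :=
  match e with
  | Cst k => k
  | Reg r => s (inl r)
  | Mem a => s (inr (eval s a))
  | Op o e1 e2 => binop_eval o (eval s e1) (eval s e2)
  end.

Fixpoint expr_cost (s : state) (e : expr) : nat :=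
  match e with
  | Cst k => bitlen k
  | Reg r => access_cost (inl r) (s (inl r))
  | Mem a =>
      let l := inr (eval s a) in expr_cost s a + access_cost l (s l)
  | Op o e1 e2 =>
      expr_cost s e1 + expr_cost s e2 + binop_cost o (eval s e1) (eval s e2)
  end.

(* A trace lists the accesses to the store, each with the value read or
   written. *)
Definition trace := seq (loc * nat).

Fixpoint expr_trace (s : state) (e : expr) : trace :=
  match e with
  | Cst _ => [::]
  | Reg r => [:: (inl r, s (inl r))]
  | Mem a =>
      let l := inr (eval s a) in rcons (expr_trace s a) (l, s l)
  | Op _ e1 e2 => expr_trace s e1 ++ expr_trace s e2
  end.

(* [exec c s s' t tr]: started in [s], the program [c] halts in [s'] after time
   [t], with trace [tr].  A test succeeds when its value is nonzero. *)
Inductive exec : cmd -> state -> state -> nat -> trace -> Prop :=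
  | ExecSkip s : exec Skip s s 1 [::]
  | ExecSetReg s r e :
      let l := inl r in let v := eval s e in
      exec (SetReg r e) s (upd s l v)
           (expr_cost s e + access_cost l v)
           (rcons (expr_trace s e) (l, v))
  | ExecSetMem s a e :
      let l := inr (eval s a) in let v := eval s e in
      exec (SetMem a e) s (upd s l v)
           (expr_cost s a + expr_cost s e + access_cost l v)
           (rcons (expr_trace s a ++ expr_trace s e) (l, v))
  | ExecSeq c1 c2 s s1 s2 t1 t2 tr1 tr2 :
      exec c1 s s1 t1 tr1 -> exec c2 s1 s2 t2 tr2 ->
      exec (Seq c1 c2) s s2 (t1 + t2) (tr1 ++ tr2)
  | ExecIfTrue e c1 c2 s s' t tr :
      eval s e != 0 -> exec c1 s s' t tr ->
      exec (If e c1 c2) s s' (expr_cost s e + t) (expr_trace s e ++ tr)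
  | ExecIfFalse e c1 c2 s s' t tr :
      eval s e = 0 -> exec c2 s s' t tr ->
      exec (If e c1 c2) s s' (expr_cost s e + t) (expr_trace s e ++ tr)
  | ExecWhileTrue e c s s1 s2 t1 t2 tr1 tr2 :
      eval s e != 0 -> exec c s s1 t1 tr1 ->
      exec (While e c) s1 s2 t2 tr2 ->
      exec (While e c) s s2 (expr_cost s e + t1 + t2)
           (expr_trace s e ++ tr1 ++ tr2)
  | ExecWhileFalse e c s :
      eval s e = 0 -> exec (While e c) s s (expr_cost s e) (expr_trace s e).

(* Space under the logarithmic cost criterion: each location ever accessed counts for the length of its
   name plus the length of the longest value it is seen to hold. *)
Definition ram_space (tr : trace) : nat :=
  \sum_(l <- undup (unzip1 tr))
    (loc_len l + \max_(x <- tr | x.1 == l) bitlen x.2).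

(* Register 0 holds n, memory cells 0, ..., n^2 - 1 hold the biadjacency matrix
   row by row, and every other location holds 0. *)
Definition input n (E : bigraph n) : state := fun l =>
  match l with
  | inl r => if r == 0 then n else 0
  | inr a =>
      [exists i : 'I_n, exists j : 'I_n, (a == i * n + j) && ((i, j) \in E)]
  end.

Definition output (s : state) : nat := s (inl 0).

(* Main.v *)
From mathcomp Require Import all_boot all_order all_algebra.
From mathcomp Require Import boolp reals exp.
From mathcomp Require Import zify ring lra.
Require Import Defs.

(** Dynamic programming over column sets: process the rows one at a time and record,
    for each set X of columns, the number of ways to match the rows seen so far
    onto X.  Among the columns of degree at most 3 Delta / 2, choose a set S of about
    n / (5 Delta); its neighbourhood A has at most 3 n / 10 rows.  Process the rows
    of A first.  During this phase only sets X with at most 3 n / 10 elements occur,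
    hence at most C(n, |X|) <= 2^(9n/10) per row.  Once A is exhausted, a set that
    misses a column of S can never be completed, so only the 2^(n - |S|) sets
    containing S are kept.  The nonzero entries of each layer are kept in a queue, so
    the time is proportional to the number of sets that occur; the space is bounded
    by the time, because the logarithmic cost charges every access. *)

Set Implicit Arguments.
Unset Strict Implicit.
Unset Printing Implicit Defensive.

(** * Space is bounded by time *)

Lemma bitlen_leE L x : 0 < L -> (bitlen x <= L) = (x < 2 ^ L).
Proof.
move=> L_gt0; rewrite /bitlen; case: (posnP x) => [->|x_gt0].
  by rewrite trunc_log0 L_gt0 expn_gt0.
apply/idP/idP => [lt_log|ltxL].
  by apply: leq_trans (trunc_log_ltn x (isT : 1 < 2)) _; rewrite leq_exp2l.
by rewrite -(@ltn_exp2l 2) // (leq_ltn_trans _ ltxL) ?trunc_logP.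
Qed.

Lemma ltn_exp_bitlen x : x < 2 ^ bitlen x.
Proof. by rewrite -bitlen_leE. Qed.

Lemma bitlen_leqS x : bitlen x <= x.+1.
Proof. by rewrite bitlen_leE // (ltn_trans (ltnSn x)) // ltn_expl. Qed.

Lemma leq_bitlen x y : x <= y -> bitlen x <= bitlen y.
Proof. by move=> xy; rewrite bitlen_leE // (leq_ltn_trans xy) ?ltn_exp_bitlen. Qed.

Lemma bitlen_binop o a b : bitlen (binop_eval o a b) <= bitlen a + bitlen b.
Proof.
have [lt_a lt_b] := (ltn_exp_bitlen a, ltn_exp_bitlen b).
case: o => /=.
- rewrite bitlen_leE // expnD.
  have : 2 ^ 1 <= 2 ^ bitlen a by rewrite leq_exp2l.
  have : 2 ^ 1 <= 2 ^ bitlen b by rewrite leq_exp2l.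
  nia.
- by apply: leq_trans (leq_addr _ _); apply/leq_bitlen/leq_subr.
- by rewrite bitlen_leE // expnD ltn_mul.
- by apply: leq_trans (leq_addr _ _); apply/leq_bitlen/leq_div.
Qed.

Lemma leq_add_double_mul x y : 0 < x -> 0 < y -> x + y <= 2 * (x * y).
Proof. nia. Qed.

Lemma binop_cost_le o a b x y :
  bitlen a <= x -> bitlen b <= y -> binop_cost o a b <= 2 * (x * y).
Proof.
have : 0 < bitlen a by []; have : 0 < bitlen b by [].
case: o => /=; nia.
Qed.

Definition trace_cost (tr : trace) : nat := \sum_(x <- tr) access_cost x.1 x.2.

Lemma trace_cost_cat tr1 tr2 :
  trace_cost (tr1 ++ tr2) = trace_cost tr1 + trace_cost tr2.
Proof. by rewrite /trace_cost big_cat. Qed.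

Lemma trace_cost_rcons tr x :
  trace_cost (rcons tr x) = trace_cost tr + access_cost x.1 x.2.
Proof. by rewrite -cats1 trace_cost_cat /trace_cost big_seq1. Qed.

Lemma trace_cost_expr s e : trace_cost (expr_trace s e) <= expr_cost s e.
Proof.
elim: e => [k|r|a IHa|o e1 IH1 e2 IH2] /=.
- by rewrite /trace_cost big_nil.
- by rewrite /trace_cost big_seq1.
- by rewrite trace_cost_rcons leq_add2r.
- by rewrite trace_cost_cat; apply: leq_trans (leq_add IH1 IH2) (leq_addr _ _).
Qed.

Lemma trace_cost_exec c s s' t tr : exec c s s' t tr -> trace_cost tr <= t.
Proof.
elim=> {c s s' t tr}
  [s|s r e l v|s a e l v|c1 c2 s s1 s2 t1 t2 tr1 tr2 _ IH1 _ IH2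
  |e c1 c2 s s' t tr _ _ IH|e c1 c2 s s' t tr _ _ IH
  |e c s s1 s2 t1 t2 tr1 tr2 _ _ IH1 _ IH2|e c s _].
- by rewrite /trace_cost big_nil.
- by rewrite trace_cost_rcons leq_add2r trace_cost_expr.
- by rewrite trace_cost_rcons leq_add2r trace_cost_cat leq_add ?trace_cost_expr.
- by rewrite trace_cost_cat leq_add.
- by rewrite trace_cost_cat leq_add ?trace_cost_expr.
- by rewrite trace_cost_cat leq_add ?trace_cost_expr.
- by rewrite !trace_cost_cat -addnA !leq_add ?trace_cost_expr.
- exact: trace_cost_expr.
Qed.

Lemma ram_space_le_trace_cost tr : ram_space tr <= trace_cost tr.
Proof.
rewrite /ram_space /trace_cost.
apply: (@leq_trans (\sum_(l <- undup (unzip1 tr))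
          \sum_(x <- tr | x.1 == l) access_cost x.1 x.2)).
  rewrite big_seq_cond [leqRHS]big_seq_cond.
  apply: leq_sum => l; rewrite andbT mem_undup => /mapP [x0 x0tr ->] {l}.
  rewrite /access_cost big_split leq_add //=.
    by rewrite (big_rem x0) //= eqxx leq_addr.
  elim/big_rec2: _ => // x m1 m2 _ /= le12.
  by rewrite geq_max leq_addr (leq_trans le12) ?leq_addl.
rewrite (exchange_big_dep predT) //= big_seq_cond [leqRHS]big_seq_cond.
apply: leq_sum => x /andP [xtr _].
rewrite (eq_bigl (pred1 x.1)) => [|l]; last by rewrite /= eq_sym.
by rewrite -big_filter filter_pred1_uniq ?undup_uniq ?mem_undup ?map_f // big_seq1.
Qed.

Lemma ram_space_le_time c s s' t tr : exec c s s' t tr -> ram_space tr <= t.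
Proof. by move=> /trace_cost_exec; apply: leq_trans (ram_space_le_trace_cost tr). Qed.

(** * A program logic with step counts *)

Definition reg (s : state) (r : nat) : nat := s (inl r).

Definition memory (s : state) : nat -> nat := fun a => s (inr a).

Fixpoint assigns (c : cmd) (r : nat) : bool :=
  match c with
  | Skip | SetMem _ _ => false
  | SetReg r' _ => r == r'
  | Seq c1 c2 | If _ c1 c2 => assigns c1 r || assigns c2 r
  | While _ c => assigns c r
  end.

Fixpoint stores (c : cmd) : bool :=
  match c with
  | Skip | SetReg _ _ => false
  | SetMem _ _ => true
  | Seq c1 c2 | If _ c1 c2 => stores c1 || stores c2
  | While _ c => stores c
  end.

Definition unchanged (c : cmd) (s s' : state) : Prop :=
  (forall r, ~~ assigns c r -> reg s' r = reg s r) /\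
  (~~ stores c -> memory s' = memory s).

Lemma unchanged_refl c s : unchanged c s s.
Proof. by []. Qed.

Lemma unchanged_trans c1 c2 c s1 s2 s3 :
  (forall r, assigns c1 r || assigns c2 r -> assigns c r) ->
  (stores c1 || stores c2 -> stores c) ->
  unchanged c1 s1 s2 -> unchanged c2 s2 s3 -> unchanged c s1 s3.
Proof.
move=> sub_assigns sub_stores [reg12 mem12] [reg23 mem23]; split=> [r|] nc.
  have /norP [n1 n2] := contraNN (sub_assigns r) nc.
  by rewrite reg23 ?reg12.
have /norP [n1 n2] := contraNN sub_stores nc.
by rewrite mem23 ?mem12.
Qed.

Lemma reg_upd s r v r' : reg (upd s (inl r) v) r' = if r' == r then v else reg s r'.
Proof. by []. Qed.

Lemma reg_upd_cell s a v r : reg (upd s (inr a) v) r = reg s r.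
Proof. by []. Qed.

Lemma memory_upd_reg s r v : memory (upd s (inl r) v) = memory s.
Proof. by []. Qed.

Lemma unchanged_upd s r e v : unchanged (SetReg r e) s (upd s (inl r) v).
Proof. by split=> // r' /= /negbTE ne; rewrite reg_upd ne. Qed.

Lemma exec_unchanged c s s' t tr : exec c s s' t tr -> unchanged c s s'.
Proof.
elim=> {c s s' t tr}
  [s|s r e|s a e|c1 c2 s s1 s2 t1 t2 tr1 tr2 _ un1 _ un2
  |e c1 c2 s s' t tr _ _ un|e c1 c2 s s' t tr _ _ un
  |e c s s1 s2 t1 t2 tr1 tr2 _ _ un1 _ un2|e c s _].
- exact: unchanged_refl.
- exact: unchanged_upd.
- by [].
- exact: unchanged_trans un1 un2.
- by apply: unchanged_trans un (unchanged_refl c2 _).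
- by apply: unchanged_trans (unchanged_refl c1 _) un.
- by apply: unchanged_trans un1 un2 => [r|] /=; rewrite orbb.
- exact: unchanged_refl.
Qed.

(* With L bounding the length of every stored value, an expression of size k has
   a value of length at most k L and costs at most (k L)^2. *)
Fixpoint expr_size (e : expr) : nat :=
  match e with
  | Cst k => k.+1
  | Reg r => r.+2
  | Mem a => (expr_size a).+1
  | Op _ e1 e2 => expr_size e1 + expr_size e2
  end.

Fixpoint max_step_size (c : cmd) : nat :=
  match c with
  | Skip => 1
  | SetReg r e => expr_size e + r.+2
  | SetMem a e => expr_size a + expr_size e
  | Seq c1 c2 => maxn (max_step_size c1) (max_step_size c2)
  | If e c1 c2 => maxn (expr_size e) (maxn (max_step_size c1) (max_step_size c2))
  | While e c => maxn (expr_size e) (max_step_size c)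
  end.

Lemma expr_size_gt0 e : 0 < expr_size e.
Proof. by elim: e => //= o e1 IH1 e2 _; rewrite addn_gt0 IH1. Qed.

Definition For (r : nat) (b : expr) (c : cmd) : cmd :=
  Seq (SetReg r (Cst 0))
      (While (Op Sub b (Reg r)) (Seq c (SetReg r (Op Add (Reg r) (Cst 1))))).

Definition for_steps (m N : nat) : nat := (m * N.+2).+2.

Section Run.

Variables L W : nat.

Definition bounded (s : state) : Prop := forall l, bitlen (s l) <= L.

Lemma bounded_gt0 s : bounded s -> 0 < L.
Proof. by move/(_ (inl 0)); apply: leq_trans. Qed.

Lemma bounded_upd s l v : bounded s -> v < 2 ^ L -> bounded (upd s l v).
Proof.
by move=> bs lt_v l'; rewrite /upd; case: eqP => // _; rewrite bitlen_leE ?(bounded_gt0 bs).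
Qed.

Lemma bitlen_eval s e : bounded s -> bitlen (eval s e) <= expr_size e * L.
Proof.
move=> bs; have L_gt0 := bounded_gt0 bs; elim: e => [k|r|a _|o e1 IH1 e2 IH2] /=.
- by rewrite (leq_trans (bitlen_leqS k)) // leq_pmulr.
- by rewrite (leq_trans (bs _)) // leq_pmull.
- by rewrite (leq_trans (bs _)) // leq_pmull.
- by rewrite (leq_trans (bitlen_binop o _ _)) // mulnDl leq_add.
Qed.

Lemma expr_cost_le s e : bounded s -> expr_cost s e <= (expr_size e * L) ^ 2.
Proof.
move=> bs; have L_gt0 := bounded_gt0 bs.
elim: e => [k|r|a IHa|o e1 IH1 e2 IH2] /=; rewrite -mulnn.
- rewrite (leq_trans (bitlen_leqS k)) // (@leq_trans (k.+1 * L)) ?leq_pmulr //.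
  by rewrite muln_gt0 L_gt0.
- have := bitlen_leqS r; have := bs (inl r); rewrite /access_cost /=; nia.
- rewrite mulnn -addn1 mulnDl mul1n sqrnD -addnA leq_add //.
  rewrite (leq_trans _ (leq_addl _ _)) //.
  rewrite (leq_trans _ (leq_add_double_mul _ L_gt0)) ?muln_gt0 ?expr_size_gt0 //.
  by rewrite leq_add ?bitlen_eval.
- rewrite mulnn mulnDl sqrnD !leq_add //.
  by rewrite binop_cost_le ?bitlen_eval.
Qed.

(* [N] counts elementary steps, each charged at most (W L)^2. *)
Definition run (c : cmd) (s : state) (N : nat) (Q : state -> Prop) : Prop :=
  bounded s -> max_step_size c <= W ->
  exists s' t tr, [/\ exec c s s' t tr, t <= N * (W * L) ^ 2, bounded s' & Q s'].

Lemma run_consequence c s N N' (Q Q' : state -> Prop) :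
  run c s N Q -> N <= N' -> (forall s', unchanged c s s' -> Q s' -> Q' s') ->
  run c s N' Q'.
Proof.
move=> runQ leN QQ' bs szW; have [s' [t [tr [ex le_t bs' Qs']]]] := runQ bs szW.
exists s', t, tr; split=> //; last exact: QQ' (exec_unchanged ex) Qs'.
by rewrite (leq_trans le_t) // leq_mul2r leN orbT.
Qed.

Lemma run_skip s N (Q : state -> Prop) : 0 < N -> Q s -> run Skip s N Q.
Proof.
move=> N_gt0 Qs bs /= W_gt0; exists s, 1, [::]; split=> //; first exact: ExecSkip.
by rewrite muln_gt0 N_gt0 expn_gt0 muln_gt0 W_gt0 (bounded_gt0 bs).
Qed.

Lemma run_setreg r e s (Q : state -> Prop) :
  eval s e < 2 ^ L -> Q (upd s (inl r) (eval s e)) -> run (SetReg r e) s 1 Q.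
Proof.
move=> lt_v Qs bs /= szW; have L_gt0 := bounded_gt0 bs; do 3 eexists.
split; [exact: ExecSetReg | | exact: bounded_upd | by []].
rewrite mul1n (@leq_trans (((expr_size e + r.+2) * L) ^ 2)) //; last first.
  by rewrite leq_exp2r // leq_mul2r szW orbT.
rewrite mulnDl sqrnD -addnA leq_add ?expr_cost_le // (leq_trans _ (leq_addl _ _)) //.
rewrite (leq_trans _ (leq_add_double_mul _ _)) ?muln_gt0 ?expr_size_gt0 //.
rewrite (leq_trans _ (leq_addl _ _)) // mulSn addnC leq_add //=; last by rewrite bitlen_leE.
by rewrite (leq_trans (bitlen_leqS r)) // leq_pmulr.
Qed.

Lemma run_setmem a e s (Q : state -> Prop) :
  eval s e < 2 ^ L -> Q (upd s (inr (eval s a)) (eval s e)) ->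
  run (SetMem a e) s 1 Q.
Proof.
move=> lt_v Qs bs /= szW; have L_gt0 := bounded_gt0 bs; do 3 eexists.
split; [exact: ExecSetMem | | exact: bounded_upd | by []].
rewrite mul1n (@leq_trans (((expr_size a + expr_size e) * L) ^ 2)) //; last first.
  by rewrite leq_exp2r // leq_mul2r szW orbT.
rewrite mulnDl sqrnD (leq_add (leq_add _ _)) ?expr_cost_le //.
rewrite (leq_trans _ (leq_add_double_mul _ _)) ?muln_gt0 ?expr_size_gt0 //.
by rewrite leq_add ?bitlen_eval // (@leq_trans L) ?bitlen_leE ?leq_pmull ?expr_size_gt0.
Qed.

Lemma run_seq N1 N2 c1 c2 s (Q : state -> Prop) :
  run c1 s N1 (fun s1 => run c2 s1 N2 Q) -> run (Seq c1 c2) s (N1 + N2) Q.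
Proof.
move=> run1 bs /=; rewrite geq_max => /andP [sz1 sz2].
have [s1 [t1 [tr1 [ex1 le1 bs1 run2]]]] := run1 bs sz1.
have [s2 [t2 [tr2 [ex2 le2 bs2 Qs2]]]] := run2 bs1 sz2.
exists s2, (t1 + t2), (tr1 ++ tr2); split=> //; first exact: ExecSeq ex1 ex2.
by rewrite mulnDl leq_add.
Qed.

Lemma run_call N1 N2 c1 c2 s (P Q : state -> Prop) :
  run c1 s N1 P -> (forall s1, unchanged c1 s s1 -> P s1 -> run c2 s1 N2 Q) ->
  run (Seq c1 c2) s (N1 + N2) Q.
Proof. by move=> run1 run2; apply: run_seq; apply: run_consequence run1 _ run2. Qed.

Lemma test_cost_le s e : bounded s -> expr_size e <= W -> expr_cost s e <= (W * L) ^ 2.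
Proof.
move=> bs szW; rewrite (leq_trans (expr_cost_le e bs)) //.
by rewrite leq_exp2r // leq_mul2r szW orbT.
Qed.

Lemma run_if N e c1 c2 s (Q : state -> Prop) :
  (if eval s e != 0 then run c1 s N Q else run c2 s N Q) ->
  run (If e c1 c2) s N.+1 Q.
Proof.
move=> run_c bs /=; rewrite !geq_max => /and3P [sz_e sz1 sz2].
have le_e := test_cost_le bs sz_e.
case: eqP run_c => /= [e0|/eqP e0] run_c.
- have [s' [t [tr [ex le_t bs' Qs']]]] := run_c bs sz2.
  do 3 eexists; split; [exact: ExecIfFalse e0 ex | | by [] | by []].
  by rewrite mulSn leq_add.
- have [s' [t [tr [ex le_t bs' Qs']]]] := run_c bs sz1.
  do 3 eexists; split; [exact: ExecIfTrue e0 ex | | by [] | by []].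
  by rewrite mulSn leq_add.
Qed.

Lemma run_while (I : nat -> state -> Prop) m N e c s :
  (forall k s, k <= m -> I k s -> (eval s e != 0) = (k < m)) ->
  (forall k s, k < m -> I k s -> run c s N (I k.+1)) ->
  I 0 s -> run (While e c) s (m * N.+1).+1 (I m).
Proof.
move=> testE run_c I0 bs /=; rewrite geq_max => /andP [sz_e sz_c].
suff loop d k s0 : k + d = m -> I k s0 -> bounded s0 -> exists s' t tr,
    [/\ exec (While e c) s0 s' t tr, t <= (d * N.+1).+1 * (W * L) ^ 2,
        bounded s' & I m s'].
  exact: loop I0 bs.
elim: d k s0 => [|d IHd] k s0 kd Ik bs0.
  rewrite addn0 in kd; subst k; exists s0, (expr_cost s0 e), (expr_trace s0 e).
  split=> //; last by rewrite mul0n mul1n test_cost_le.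
  by apply: ExecWhileFalse; apply/eqP; apply: negbFE; rewrite (testE m) ?ltnn.
have km : k < m by rewrite -kd addnS ltnS leq_addr.
have [s1 [t1 [tr1 [ex1 le1 bs1 I1]]]] := run_c k s0 km Ik bs0 sz_c.
have [|s2 [t2 [tr2 [ex2 le2 bs2 Im]]]] := IHd k.+1 s1 _ I1 bs1; first by rewrite addSnnS.
do 3 eexists; split; [apply: ExecWhileTrue ex1 ex2 | | by [] | by []].
  by rewrite (testE k) // ltnW.
have -> : (d.+1 * N.+1).+1 = 1 + N + (d * N.+1).+1 by lia.
by rewrite !mulnDl mul1n !leq_add ?test_cost_le.
Qed.

Lemma run_for (I : nat -> state -> Prop) m N r b c s (Q : state -> Prop) :
  m < 2 ^ L -> ~~ assigns c r ->
  (forall s', unchanged (For r b c) s s' -> eval s' b = m) ->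
  I 0 (upd s (inl r) 0) ->
  (forall k s', k < m -> unchanged (For r b c) s s' -> reg s' r = k -> I k s' ->
     run c s' N (fun s1 => I k.+1 (upd s1 (inl r) k.+1))) ->
  (forall s', unchanged (For r b c) s s' -> I m s' -> Q s') ->
  run (For r b c) s (for_steps m N) Q.
Proof.
move=> ltmL fresh_r b_m I0 run_c IQ.
pose J k s' := [/\ unchanged (For r b c) s s', reg s' r = k & I k s'].
suff runJ : run (For r b c) s (for_steps m N) (J m).
  by apply: run_consequence runJ _ _ => // s' _ [un _]; apply: IQ.
apply: (@run_seq 1 (m * N.+2).+1); apply: run_setreg => /=; first by rewrite expn_gt0.
apply: run_while => [k s1 _ [un1 r1 _]|k s1 km [un1 r1 Ik]|].
- by rewrite /= b_m // -/(reg s1 r) r1 subn_eq0 -ltnNge.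
- rewrite -[N.+1]addn1; apply: run_seq.
  apply: run_consequence (run_c k s1 km un1 r1 Ik) _ _ => // s2 un2 Ik1.
  have r2 : reg s2 r = k by rewrite un2.1.
  apply: run_setreg => /=; rewrite -/(reg s2 r) r2 addn1; first exact: leq_ltn_trans ltmL.
  split=> //; last by rewrite reg_upd eqxx.
  have un13 : unchanged (For r b c) s1 (upd s2 (inl r) k.+1).
    apply: unchanged_trans un2 (unchanged_upd s2 r (Cst 0) k.+1) => //= r'.
    by case/orP => ->; rewrite ?orbT.
  by apply: unchanged_trans un1 un13 => [r'|]; rewrite orbb.
- split=> //; last by rewrite reg_upd eqxx.
  by split=> // r' /= /norP [/negbTE ne _]; rewrite reg_upd ne.
Qed.

End Run.

(** * Counting matchings row by row *)

Lemma sum_card_fibers (T I : finType) (A : {set T}) (f : T -> I) (P : pred I) :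
  \sum_(i | P i) #|[set x in A | f x == i]| = #|[set x in A | P (f x)]|.
Proof.
rewrite -[RHS]sum1_card (partition_big f P) /= => [|x]; last by rewrite inE => /andP [].
apply: eq_bigr => i Pi; rewrite -sum1_card; apply: eq_bigl => x.
by rewrite !inE; case: eqVneq => [->|]; rewrite ?Pi ?andbT ?andbF.
Qed.

Lemma leq_sum_bool (T : finType) (P b : pred T) : \sum_(x | P x) b x <= #|T|.
Proof.
rewrite (leq_trans _ (max_card P)) // -sum1_card.
by apply: leq_sum => x _; apply: leq_b1.
Qed.

Definition degree n (M : bigraph n) (v : vertex n) : nat := #|[set e in M | incident v e]|.

Section Degree.

Variable n : nat.
Implicit Types (M : bigraph n) (v : vertex n) (e : 'I_n * 'I_n).

Lemma degreeU1 M e v : e \notin M -> degree (e |: M) v = incident v e + degree M v.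
Proof.
rewrite /degree => eM; have [ve|nve] := boolP (incident v e).
  have -> : [set e' in e |: M | incident v e'] = e |: [set e' in M | incident v e'].
    by apply/setP=> e'; rewrite !inE; case: eqVneq => [->|].
  by rewrite cardsU1 inE (negbTE eM).
apply: eq_card => e'; rewrite !inE.
by case: eqVneq => [->|] //=; rewrite (negbTE nve) (negbTE eM).
Qed.

Lemma degree_gt0 M e v : e \in M -> incident v e -> 0 < degree M v.
Proof. by move=> eM ve; rewrite card_gt0; apply/set0Pn; exists e; rewrite inE eM. Qed.

Lemma degreeE M v : degree M v = \sum_i \sum_j ((i, j) \in M) * incident v (i, j).
Proof.
rewrite /degree -sum1_card big_mkcond pair_bigA; apply: eq_bigr => -[i j] _.
by rewrite inE mulnb; case: (_ && _).
Qed.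

Lemma degree_inl M (i : 'I_n) : degree M (inl i) = \sum_j ((i, j) \in M).
Proof.
rewrite degreeE (bigD1 i) //= [X in _ + X]big1 ?addn0 => [|k ki].
  by apply: eq_bigr => j _; rewrite eqxx muln1.
by apply: big1 => j _; rewrite (negbTE ki) muln0.
Qed.

Lemma degree_inr M (j : 'I_n) : degree M (inr j) = \sum_i ((i, j) \in M).
Proof.
rewrite degreeE exchange_big (bigD1 j) //= [X in _ + X]big1 ?addn0 => [|k kj].
  by apply: eq_bigr => i _; rewrite eqxx muln1.
by apply: big1 => i _; rewrite (negbTE kj) muln0.
Qed.

Lemma degree_inr_le M (j : 'I_n) : degree M (inr j) <= n.
Proof. by rewrite degree_inr -[leqRHS]card_ord leq_sum_bool. Qed.

Lemma sum_degree_inl M (P : pred 'I_n) :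
  \sum_(i | P i) degree M (inl i) = #|[set e in M | P e.1]|.
Proof. exact: sum_card_fibers. Qed.

Lemma sum_degree_inr M (P : pred 'I_n) :
  \sum_(j | P j) degree M (inr j) = #|[set e in M | P e.2]|.
Proof. exact: sum_card_fibers. Qed.

End Degree.

Section Matchings.

Variables (n : nat) (E : bigraph n).
Implicit Types (R X : {set 'I_n}) (M : bigraph n) (v : vertex n).

Definition endpoint R X v : bool :=
  match v with inl i => i \in R | inr j => j \in X end.

Definition matchings R X : {set bigraph n} :=
  [set M : bigraph n | (M \subset E) && [forall v, degree M v == endpoint R X v]].

Lemma matchingsP R X M :
  reflect (M \subset E /\ forall v, degree M v = endpoint R X v) (M \in matchings R X).
Proof.
rewrite inE; apply: (iffP andP) => -[ME degM]; split=> //.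
  by move=> v; apply/eqP/(forallP degM).
by apply/forallP => v; rewrite degM.
Qed.

Lemma matchings_setT : matchings setT setT = perfect_matchings E.
Proof.
apply/setP => M; rewrite !inE /perfect_matching; congr (_ && _).
by apply: eq_forallb => -[k|k]; rewrite /= inE.
Qed.

Lemma matchings_neq0_card R X : #|matchings R X| != 0 -> #|X| = #|R|.
Proof.
rewrite cards_eq0 => /set0Pn [M /matchingsP [_ degM]].
have card_sum (Y : {set 'I_n}) : #|Y| = \sum_i (i \in Y : nat).
  by rewrite -sum1_card big_mkcond.
have -> : #|X| = \sum_j degree M (inr j).
  by rewrite card_sum; under [RHS]eq_bigr do rewrite degM.
have -> : #|R| = \sum_i degree M (inl i).
  by rewrite card_sum; under [RHS]eq_bigr do rewrite degM.
by rewrite (sum_degree_inl M predT) (sum_degree_inr M predT).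
Qed.

Lemma matchings_set0 X : #|matchings set0 X| = (X == set0).
Proof.
case: eqVneq => [->|X_neq0]; last first.
  apply/eqP; apply: contraNT X_neq0 => /matchings_neq0_card.
  by rewrite cards0 => /eqP; rewrite cards_eq0.
apply/eqP/cards1P; exists set0; apply/setP => M; rewrite in_set1.
apply/matchingsP/eqP => [[_ degM]|->]; last first.
  split=> [|v]; first exact: sub0set.
  by rewrite /degree eq_card0 => [|e]; [case: v => k; rewrite /= inE | rewrite !inE].
apply/setP => -[i j]; rewrite inE; apply/negP => ijM.
by have := degree_gt0 ijM (eqxx i : incident (inl i) (i, j)); rewrite degM /= inE.
Qed.

Lemma card_matchings_le R X : #|matchings R X| <= 2 ^ (n * n).
Proof.
apply: leq_trans (max_card _) _.
by rewrite -cardsT -powersetT card_powerset cardsT card_prod card_ord.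
Qed.

Lemma endpointU1 R X (r j : 'I_n) v : r \notin R -> j \in X ->
  endpoint (r |: R) X v = incident v (r, j) + endpoint R (X :\ j) v :> nat.
Proof.
move=> rR jX; case: v => k; rewrite /= !inE [_ == k]eq_sym.
  by case: eqVneq => [->|] //; rewrite (negbTE rR).
by case: eqVneq => [->|] //; rewrite jX.
Qed.

Lemma matchings_edge R X M (r j : 'I_n) :
  M \in matchings (r |: R) X -> (r, j) \in M -> (j \in X) && ((r, j) \in E).
Proof.
move=> /matchingsP [ME degM] rjM; rewrite (subsetP ME) // andbT.
have := degree_gt0 rjM (eqxx j : incident (inr j) (r, j)).
by rewrite degM /=; case: (j \in X).
Qed.

Lemma matchings_new_row R X M (r j : 'I_n) :
  r \notin R -> M \in matchings R X -> (r, j) \notin M.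
Proof.
move=> rR /matchingsP [_ degM]; apply/negP => rjM.
have := degree_gt0 rjM (eqxx r : incident (inl r) (r, j)).
by rewrite degM /= (negbTE rR).
Qed.

Lemma matchings_with_edge R X (r j : 'I_n) :
  r \notin R -> j \in X -> (r, j) \in E ->
  [set M in matchings (r |: R) X | (r, j) \in M] =
  [set (r, j) |: M | M in matchings R (X :\ j)].
Proof.
move=> rR jX rjE; apply/setP => M; rewrite inE; apply/andP/imsetP => [[]|[M' M'm ->]].
  move=> /matchingsP [ME degM] rjM; exists (M :\ (r, j)); last by rewrite setD1K.
  apply/matchingsP; split=> [|v]; first exact: subset_trans (subsetDl _ _) ME.
  apply/eqP; rewrite -(eqn_add2l (incident v (r, j))) -(endpointU1 v rR jX) -degM.
  by rewrite -{2}(setD1K rjM) degreeU1 // !inE eqxx.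
have rjM' := matchings_new_row j rR M'm; case/matchingsP: M'm => ME degM.
split; last exact: setU11.
apply/matchingsP; split=> [|v]; first by rewrite subUset sub1set rjE.
by rewrite degreeU1 // degM (endpointU1 v rR jX).
Qed.

Lemma card_matchingsU1 R X (r : 'I_n) : r \notin R ->
  #|matchings (r |: R) X| = \sum_(j in X | (r, j) \in E) #|matchings R (X :\ j)|.
Proof.
move=> rR.
transitivity (\sum_(M in matchings (r |: R) X) \sum_j ((r, j) \in M : nat)).
  rewrite -sum1_card; apply: eq_bigr => M /matchingsP [_ degM].
  by rewrite -degree_inl degM /= setU11.
rewrite exchange_big [RHS]big_mkcond /=; apply: eq_bigr => j _.
rewrite -big_mkcondr sum1dep_card; case: ifPn => [/andP [jX rjE]|no_edge].
  rewrite matchings_with_edge // card_in_imset // => M1 M2 M1m M2m eqM.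
  rewrite -(setU1K (matchings_new_row j rR M1m)) eqM setU1K //.
  exact: matchings_new_row M2m.
apply: eq_card0 => M; rewrite inE; apply/negP => /andP [Mm rjM].
by rewrite (matchings_edge Mm rjM) in no_edge.
Qed.

End Matchings.

Section Counting.

Variable T : finType.
Implicit Types (P : {set {set T}}).

Lemma card_uniform_family P k : (forall X, X \in P -> #|X| = k) -> #|P| <= 'C(#|T|, k).
Proof.
move=> cardP; rewrite -card_draws; apply/subset_leq_card/subsetP => X /cardP cardX.
by rewrite inE cardX.
Qed.

Lemma card_superset_family P (S : {set T}) :
  (forall X, X \in P -> S \subset X) -> #|P| <= 2 ^ (#|T| - #|S|).
Proof.
move=> supP; rewrite -(setCK S) -cardsCs -card_powerset.
have injD : {in P &, injective (fun X => X :\: S)}.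
  move=> X Y /supP SX /supP SY eqXY.
  by rewrite -(setID X S) -(setID Y S) eqXY (setIidPr SX) (setIidPr SY).
rewrite -(card_in_imset injD); apply/subset_leq_card/subsetP => _ /imsetP [X _ ->].
by rewrite inE setDE subsetIr.
Qed.

Lemma size_uniq_sets (ls : seq {set T}) : uniq ls -> size ls <= 2 ^ #|T|.
Proof.
move=> /card_uniqP <-; rewrite (leq_trans (max_card _)) //.
by rewrite -cardsT -powersetT card_powerset cardsT.
Qed.

End Counting.

Section DynamicProgramming.

Variables (n : nat) (E : bigraph n).
Implicit Types (D R X Y : {set 'I_n}) (F : {set 'I_n} -> nat) (r j : 'I_n).

Definition supp F : {set {set 'I_n}} := [set X | F X != 0].

Definition enumerates (ls : seq {set 'I_n}) F : Prop := uniq ls /\ ls =i supp F.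

Definition contrib r F Y j X : nat := [&& j \notin Y, (r, j) \in E & X == j |: Y] * F Y.

Definition next_layer D r F X : nat :=
  \sum_(Y : {set 'I_n} | D \subset Y) \sum_j contrib r F Y j X.

Lemma next_layerE D r F X :
  next_layer D r F X = \sum_(j in X | ((r, j) \in E) && (D \subset X :\ j)) F (X :\ j).
Proof.
rewrite /next_layer exchange_big [RHS]big_mkcond /=; apply: eq_bigr => j _.
rewrite /contrib; case: ifPn => [/and3P [jX rj DX]|no_pred].
  rewrite (bigD1 (X :\ j)) //= rj !inE eqxx setD1K // eqxx mul1n big1 ?addn0 // => Y.
  case/andP => _; apply: contra_neq_eq; rewrite muln_eq0 negb_or eqb0 negbK.
  by case/andP => /and3P [jY _ /eqP ->] _; rewrite setU1K.
apply: big1 => Y DY; apply/eqP; rewrite muln_eq0 eqb0; apply/orP; left.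
by apply: contraNN no_pred => /and3P [jY rj /eqP ->]; rewrite setU11 rj setU1K.
Qed.

Lemma sum_enumerated D r F ls X : enumerates ls F ->
  \sum_(Y <- ls | D \subset Y) \sum_j contrib r F Y j X = next_layer D r F X.
Proof.
move=> [uniq_ls memls]; rewrite big_mkcond big_uniq //=.
rewrite /next_layer [LHS]big_mkcond [RHS]big_mkcond.
apply: eq_bigr => Y _; rewrite memls inE; case: eqP => //= F0.
by case: ifP => // _; rewrite big1 // => j _; rewrite /contrib F0 muln0.
Qed.

Lemma sum_take_enumerated D r F ls k X : enumerates ls F ->
  \sum_(Y <- take k ls | D \subset Y) \sum_j contrib r F Y j X <= next_layer D r F X.
Proof.
move=> enum_ls; rewrite -(sum_enumerated D r X enum_ls) -[in leqRHS](cat_take_drop k ls).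
by rewrite big_cat leq_addr.
Qed.

Lemma size_enumeration ls F : enumerates ls F -> size ls = #|supp F|.
Proof. by case=> /card_uniqP <- memls; apply: eq_card. Qed.

(* A set missing an element of D may be undercounted: it has been discarded since
   it cannot be completed to a perfect matching. *)
Definition tracks D R F : Prop :=
  (forall X, F X <= #|matchings E R X|) /\
  (forall X, D \subset X -> F X = #|matchings E R X|).

Lemma tracks_set0 : tracks set0 set0 (fun X => X == set0).
Proof. by split=> X; rewrite matchings_set0. Qed.

Lemma tracksW D D' R F : D \subset D' -> tracks D R F -> tracks D' R F.
Proof. by move=> DD' [F_le F_eq]; split=> // X D'X; apply/F_eq/(subset_trans DD'). Qed.

Lemma tracks_card D R F X : tracks D R F -> F X != 0 -> #|X| = #|R|.
Proof.
move=> [F_le _] FX; apply: (@matchings_neq0_card n E).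
by rewrite -lt0n (leq_trans _ (F_le X)) ?lt0n.
Qed.

Lemma tracks_next_layer D R F r : r \notin R -> (forall j, j \in D -> (r, j) \notin E) ->
  tracks D R F -> tracks D (r |: R) (next_layer D r F).
Proof.
move=> rR rD [F_le F_eq]; split=> X; rewrite next_layerE card_matchingsU1 //.
  rewrite big_mkcond [leqRHS]big_mkcond; apply: leq_sum => j _.
  by case: (j \in X) => //=; case: (_ \in E) => //=; case: ifP.
move=> DX; rewrite big_mkcond [RHS]big_mkcond; apply: eq_bigr => j _.
case: (j \in X) => //=; case: (boolP (_ \in E)) => //= rj.
have DXj : D \subset X :\ j by rewrite subsetD1 DX; apply: contraL rj => /rD.
by rewrite DXj F_eq.
Qed.

Lemma tracks_setT D F : tracks D setT F -> F setT = #|perfect_matchings E|.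
Proof. by case=> _ F_eq; rewrite F_eq ?subsetT // matchings_setT. Qed.

Lemma supp_next_layer_superset D r F X : X \in supp (next_layer D r F) -> D \subset X.
Proof.
rewrite inE next_layerE; apply: contraNT => nDX; rewrite big_pred0 // => j.
apply: contraNF nDX => /and3P [_ _ DXj]; exact: subset_trans DXj (subD1set _ _).
Qed.

End DynamicProgramming.

Section Selection.

Variables (n : nat) (E : bigraph n).
Implicit Types S : {set 'I_n}.

(* With Delta = |E| / n, the conditions read deg j <= 3 Delta / 2 and
   k <= n / (5 Delta). *)
Definition light (j : 'I_n) : bool := 2 * degree E (inr j) * n <= 3 * #|E|.

Definition affordable (k : nat) : bool := 5 * #|E| * k <= n * n.

Definition neighbours S : {set 'I_n} := [set i | [exists j in S, (i, j) \in E]].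

Definition greedy (m : nat) S : Prop :=
  [/\ forall j, j \in S -> light j && (j < m), affordable #|S|
    & affordable #|S|.+1 -> forall j : 'I_n, j < m -> light j -> j \in S].

Lemma greedy0 : greedy 0 set0.
Proof. by split=> [j||//]; rewrite ?inE // /affordable cards0 muln0. Qed.

Lemma greedyU1 S (j : 'I_n) : greedy j S -> light j -> affordable #|S|.+1 ->
  j \notin S -> greedy j.+1 (j |: S).
Proof.
move=> [S_light _ S_full] light_j aff jS; split=> [k||_ k].
- rewrite in_setU1 ltnS => /predU1P [->|/S_light /andP [-> /ltnW //]].
  by rewrite light_j leqnn.
- by rewrite cardsU1 jS.
- rewrite ltnS leq_eqVlt in_setU1 (inj_eq val_inj).
  by case: eqVneq => //= _; apply: S_full.
Qed.

Lemma greedy_skip S (j : 'I_n) : greedy j S -> ~~ (light j && affordable #|S|.+1) ->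
  greedy j.+1 S.
Proof.
move=> [S_light S_aff S_full] skip; split=> // [k /S_light /andP [-> /ltnW //]|aff k].
rewrite ltnS leq_eqVlt (inj_eq val_inj) => /predU1P [->|kj] light_k; last exact: S_full.
by rewrite light_k aff in skip.
Qed.

Lemma card_neighbours_le S : #|neighbours S| <= \sum_(j in S) degree E (inr j).
Proof.
rewrite (sum_degree_inr E (mem S)); apply: leq_trans (leq_imset_card fst _).
apply/subset_leq_card/subsetP => i; rewrite inE => /exists_inP [j jS ij].
by apply/imsetP; exists (i, j); rewrite ?inE ?ij.
Qed.

Lemma card_light_neighbours_le S : 0 < n -> (forall j, j \in S -> light j) ->
  affordable #|S| -> 10 * #|neighbours S| <= 3 * n.
Proof.
move=> n_gt0 S_light; rewrite /affordable => S_aff; have := card_neighbours_le S.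
have : 2 * n * \sum_(j in S) degree E (inr j) <= #|S| * (3 * #|E|).
  rewrite -sum_nat_const big_distrr; apply: leq_sum => j /S_light; rewrite /light /=; lia.
nia.
Qed.

Lemma card_heavy_le : 0 < #|E| -> 3 * #|[set j | ~~ light j]| <= 2 * n.
Proof.
move=> E_gt0; rewrite -(@leq_pmul2r #|E|) //.
have degE : \sum_(j in [set j | ~~ light j]) degree E (inr j) <= #|E|.
  rewrite (sum_degree_inr E (fun j => j \in _)); apply/subset_leq_card/subsetP => e.
  by rewrite inE => /andP [].
rewrite -mulnA mulnCA (leq_trans _ (leq_mul (leqnn (2 * n)) degE)) //.
rewrite -sum_nat_const big_distrr; apply: leq_sum => j.
by rewrite inE -ltnNge /light /=; lia.
Qed.

Lemma greedy_not_affordable S :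
  0 < n -> 3 * n <= #|E| -> greedy n S -> ~~ affordable #|S|.+1.
Proof.
move=> n_gt0 leE [_ _ S_full]; apply/negP => aff.
have E_gt0 : 0 < #|E| by apply: leq_trans leE; rewrite muln_gt0.
have heavy := card_heavy_le E_gt0.
have : n - #|S| <= #|[set j | ~~ light j]|.
  rewrite -[n in n - _]card_ord -(setCK S) -cardsCs; apply/subset_leq_card/subsetP => j.
  by rewrite !inE; apply: contraNN => light_j; apply: S_full.
have : #|S| <= n by rewrite -[leqRHS]card_ord max_card.
by move: aff; rewrite /affordable; nia.
Qed.

End Selection.

Section Bitmask.

Lemma odd_bits n (b : 'I_n -> bool) (j : 'I_n) :
  odd ((\sum_(i < n) b i * 2 ^ i) %/ 2 ^ j) = b j.
Proof.
elim: n b j => [|n IHn] b j; first by case: j.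
rewrite big_ord_recl muln1; under eq_bigr do rewrite expnS mulnCA.
rewrite -big_distrr /=.
case: (unliftP ord0 j) => [k|] ->; last by rewrite divn1 oddD oddM oddb addbF.
rewrite /= /bump leq0n add1n expnS divnMA -(IHn (fun i => b (lift ord0 i)) k).
by congr (odd (_ %/ _)); rewrite addnC mulnC divnMDl // divn_small ?addn0 //; case: (b _).
Qed.

Variable n : nat.
Implicit Types (X : {set 'I_n}) (j : 'I_n).

Definition mask X : nat := \sum_(j in X) 2 ^ j.

Lemma odd_mask X j : odd (mask X %/ 2 ^ j) = (j \in X).
Proof.
rewrite -(odd_bits (fun j => j \in X)) /mask big_mkcond /=.
by congr (odd (_ %/ _)); apply: eq_bigr => i _; case: (_ \in _); rewrite ?mul1n.
Qed.

Lemma mask_inj : injective mask.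
Proof. by move=> X Y eqXY; apply/setP => j; rewrite -!odd_mask eqXY. Qed.

Lemma mask_set0 : mask set0 = 0.
Proof. by rewrite /mask big_set0. Qed.

Lemma mask_setT : mask setT = 2 ^ n - 1.
Proof. by rewrite subn1 predn_exp mul1n /mask; apply: eq_bigl => j; rewrite inE. Qed.

Lemma mask_setU1 X j : j \notin X -> mask (j |: X) = mask X + 2 ^ j.
Proof. by move=> jX; rewrite /mask big_setU1 //= addnC. Qed.

Lemma mask_lt X : mask X < 2 ^ n.
Proof.
rewrite -[2 ^ n]prednK ?expn_gt0 // ltnS -subn1 -mask_setT /mask.
rewrite [leqRHS](bigID (mem X)) /= (leq_trans _ (leq_addr _ _)) //.
by rewrite [leqRHS](eq_bigl (mem X)) // => j; rewrite inE.
Qed.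

End Bitmask.

Section PrefixSum.

Variable n : nat.
Implicit Type f : 'I_n -> nat.

Definition prefix_sum f (k : nat) : nat := \sum_(i < n | i < k) f i.

Lemma prefix_sum0 f : prefix_sum f 0 = 0.
Proof. exact: big_pred0. Qed.

Lemma prefix_sumS f (k : 'I_n) : prefix_sum f k.+1 = prefix_sum f k + f k.
Proof.
rewrite /prefix_sum (bigD1 k) //= addnC; congr (_ + _); apply: eq_bigl => i.
by rewrite ltnS ltn_neqAle andbC.
Qed.

Lemma prefix_sum_full f : prefix_sum f n = \sum_i f i.
Proof. by apply: eq_bigl => i; rewrite ltn_ord. Qed.

Lemma leq_prefix_sum f k : prefix_sum f k <= \sum_i f i.
Proof. by rewrite [leqRHS](bigID (fun i : 'I_n => i < k)) leq_addr. Qed.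

End PrefixSum.

(** * The program *)

Declare Scope ram_scope.
Delimit Scope ram_scope with ram.
Bind Scope ram_scope with expr.

Local Notation "$ r" := (Reg r) (at level 1, format "$ r") : ram_scope.
Local Infix "+" := (Op Add) : ram_scope.
Local Infix "-" := (Op Sub) : ram_scope.
Local Infix "*" := (Op Mul) : ram_scope.
Local Infix "/" := (Op Div) : ram_scope.
Local Notation "r ::= e" := (SetReg r e) (at level 55, e at level 54).
Local Infix ";;" := Seq (at level 60, right associativity).

Definition r_n : nat := 0.
Definition r_edges : nat := 1.
Definition r_chosen : nat := 2.
Definition r_col : nat := 3.
Definition r_row : nat := 4.
Definition r_degree : nat := 5.
Definition r_lo : nat := 6.
Definition r_hi : nat := 7.
Definition r_end : nat := 8.
Definition r_pos : nat := 9.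
Definition r_mask : nat := 10.
Definition r_pow : nat := 11.
Definition r_missing : nat := 12.

Definition a_count : nat := 0.
Definition a_queue : nat := 1.
Definition a_required : nat := 2.
Definition a_adjacent : nat := 3.

(* The four arrays are interleaved above the n^2 cells of the input. *)
Definition cell (a : nat) (e : expr) : expr := $r_n * $r_n + (Cst 4 * e + Cst a).
Definition arr (a : nat) (e : expr) : expr := Mem (cell a e).
Definition store (a : nat) (e1 e2 : expr) : cmd := SetMem (cell a e1) e2.
Definition current_edge : expr := Mem ($r_row * $r_n + $r_col).

Definition double_pow : cmd := r_pow ::= Cst 2 * $r_pow.

Definition degree_cmd : cmd :=
  r_degree ::= Cst 0 ;;
  For r_row ($r_n) (r_degree ::= $r_degree + current_edge).

Definition count_cmd : cmd :=
  For r_col ($r_n) (degree_cmd ;; r_edges ::= $r_edges + $r_degree).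

Definition mark_neighbours_cmd : cmd :=
  For r_row ($r_n)
    (store a_adjacent ($r_row) (arr a_adjacent ($r_row) + current_edge)).

Definition choose_cmd : cmd :=
  store a_required ($r_col) (Cst 1) ;;
  r_chosen ::= $r_chosen + Cst 1 ;;
  mark_neighbours_cmd.

(* With truncated subtraction, x <= y is tested by (y + 1) - x. *)
Definition leq_test (x y : expr) : expr := (y + Cst 1) - x.

Definition select_cmd : cmd :=
  For r_col ($r_n)
    (degree_cmd ;;
     If (leq_test (Cst 2 * $r_degree * $r_n) (Cst 3 * $r_edges) *
         leq_test (Cst 5 * $r_edges * ($r_chosen + Cst 1)) ($r_n * $r_n))
        choose_cmd Skip).

Definition shifted_mask : expr := $r_mask / $r_pow.
Definition absent : expr := Cst 1 - (shifted_mask - Cst 2 * (shifted_mask / Cst 2)).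
Definition target : expr := $r_mask + $r_pow.

Definition check_cmd : cmd :=
  r_missing ::= Cst 0 ;;
  r_pow ::= Cst 1 ;;
  For r_col ($r_n)
    (r_missing ::= $r_missing + arr a_required ($r_col) * absent ;; double_pow).

Definition enqueue_cmd : cmd :=
  If (arr a_count target) Skip
     (store a_queue ($r_end) target ;; r_end ::= $r_end + Cst 1).

Definition push_cmd : cmd :=
  enqueue_cmd ;;
  store a_count target (arr a_count target + arr a_count ($r_mask)).

Definition extend_cmd : cmd := If (absent * current_edge) push_cmd Skip.

Definition expand_cmd : cmd :=
  r_pow ::= Cst 1 ;; For r_col ($r_n) (extend_cmd ;; double_pow).

Definition visit_cmd (late : bool) : cmd :=
  r_mask ::= arr a_queue ($r_lo + $r_pos) ;;
  if late then check_cmd ;; If ($r_missing) Skip expand_cmd else expand_cmd.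

Definition layer_cmd (late : bool) : cmd :=
  r_hi ::= $r_end ;;
  For r_pos ($r_hi - $r_lo) (visit_cmd late) ;;
  r_lo ::= $r_hi.

(* The early pass handles the rows adjacent to a required column, the late pass
   the others. *)
Definition row_cmd (late : bool) : cmd :=
  If (arr a_adjacent ($r_row))
     (if late then Skip else layer_cmd late) (if late then layer_cmd late else Skip).

Definition pass_cmd (late : bool) : cmd := For r_row ($r_n) (row_cmd late).

Definition init_cmd : cmd :=
  store a_count (Cst 0) (Cst 1) ;; r_end ::= Cst 1.

Definition output_cmd : cmd :=
  r_pow ::= Cst 1 ;;
  For r_col ($r_n) double_pow ;;
  r_n ::= arr a_count ($r_pow - Cst 1).

Definition matching_count_cmd : cmd :=
  count_cmd ;; select_cmd ;; init_cmd ;; pass_cmd false ;; pass_cmd true ;; output_cmd.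

Arguments cell : simpl never.
Arguments arr : simpl never.
Arguments current_edge : simpl never.

Section StepCounts.

Variable n : nat.

Definition degree_steps : nat := 1 + for_steps n 1.
Definition count_steps : nat := for_steps n (degree_steps + 1).
Definition choose_steps : nat := 1 + (1 + for_steps n 1).
Definition select_steps : nat := for_steps n (degree_steps + choose_steps.+1).
Definition check_steps : nat := 1 + (1 + for_steps n (1 + 1)).
Definition enqueue_steps : nat := (1 + 1).+1.
Definition push_steps : nat := enqueue_steps + 1.
Definition expand_steps : nat := 1 + for_steps n (push_steps.+1 + 1).
Definition visit_steps : nat := 1 + (check_steps + expand_steps.+1).
Definition layer_steps (B : nat) : nat := 1 + (for_steps B visit_steps + 1).
Definition pass_steps (B : nat) : nat := for_steps n (layer_steps B).+1.
Definition init_steps : nat := 1 + 1.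
Definition output_steps : nat := 1 + (for_steps n 1 + 1).
Definition matching_count_steps (B : nat) : nat :=
  count_steps +
  (select_steps + (init_steps + (pass_steps B + (pass_steps B + output_steps)))).

Lemma matching_count_steps_le B :
  0 < B -> matching_count_steps B <= 200 * n.+1 ^ 2 * B.
Proof.
move=> B_gt0; rewrite /matching_count_steps /pass_steps /layer_steps /visit_steps.
rewrite /expand_steps /push_steps /enqueue_steps /check_steps /select_steps /choose_steps.
rewrite /count_steps /degree_steps /init_steps /output_steps /for_steps -mulnn; nia.
Qed.

End StepCounts.

(** * Correctness of the program *)

Section Memory.

Variables (n : nat) (E : bigraph n).
Implicit Types (S X Y : {set 'I_n}) (F : {set 'I_n} -> nat) (s : state) (m : nat -> nat).

Definition slot (a x : nat) : nat := n * n + (4 * x + a).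

Definition get (a : nat) m (x : nat) : nat := m (slot a x).

Definition put (a x v : nat) m : nat -> nat := [eta m with slot a x |-> v].

Lemma get_put a b x v m y : a < 4 -> b < 4 ->
  get b (put a x v m) y = if (b == a) && (y == x) then v else get b m y.
Proof.
move=> a4 b4; rewrite /get /put /= /slot eqn_add2l.
suff -> : (4 * y + b == 4 * x + a) = (b == a) && (y == x) by [].
by apply/eqP/andP => [eq_slot|[/eqP -> /eqP ->] //]; split; apply/eqP; lia.
Qed.

Lemma memory_store s a x v : memory (upd s (inr (slot a x)) v) = put a x v (memory s).
Proof. by []. Qed.

Definition encodes_graph m : Prop := forall i j : 'I_n, m (i * n + j) = ((i, j) \in E).

Lemma encodes_graph_put a x v m : encodes_graph m -> encodes_graph (put a x v m).
Proof.
move=> enc_m i j; rewrite /put /= /slot ifN ?enc_m //.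
by have := ltn_ord i; have := ltn_ord j; nia.
Qed.

Lemma encodes_graph_input : encodes_graph (memory (input E)).
Proof.
move=> i j; rewrite /memory /input; congr nat_of_bool.
apply/existsP/idP => [[i' /existsP [j' /andP [/eqP eq_ij ij']]]|ij]; last first.
  by exists i; apply/existsP; exists j; rewrite eqxx.
have n_gt0 : 0 < n by apply: leq_ltn_trans (ltn_ord i).
have -> : i = i'.
  apply: val_inj; have := congr1 (divn^~ n) eq_ij.
  by rewrite /= !divnMDl // !divn_small ?addn0.
have -> // : j = j'.
by apply: val_inj; have := congr1 (modn^~ n) eq_ij; rewrite /= !modnMDl !modn_small.
Qed.

Lemma get_input a x : get a (memory (input E)) x = 0.
Proof.
apply/eqP; rewrite eqb0; apply/existsP => -[i /existsP [j /andP [/eqP eq_ij _]]].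
by have := ltn_ord i; have := ltn_ord j; move: eq_ij; rewrite /slot; nia.
Qed.

Lemma eval_op s o e1 e2 : eval s (Op o e1 e2) = binop_eval o (eval s e1) (eval s e2).
Proof. by []. Qed.

Lemma eval_reg s r : eval s (Reg r) = reg s r.
Proof. by []. Qed.

Lemma eval_leq_test s e1 e2 : (eval s (leq_test e1 e2) != 0) = (eval s e1 <= eval s e2).
Proof. by rewrite /= addn1 subn_eq0 -ltnNge ltnS. Qed.

Lemma eval_arr s a e : reg s r_n = n -> eval s (arr a e) = get a (memory s) (eval s e).
Proof. by move=> sn; rewrite /= -/(reg s r_n) sn. Qed.

Lemma eval_current_edge s (i j : 'I_n) : reg s r_n = n -> encodes_graph (memory s) ->
  reg s r_row = i -> reg s r_col = j -> eval s current_edge = ((i, j) \in E).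
Proof. by move=> sn enc_s si sj; rewrite -enc_s -si -sj -[in RHS]sn. Qed.

Lemma odd_complement q : 1 - (q - 2 * (q %/ 2)) = ~~ odd q.
Proof. by rewrite {1}(divn_eq q 2) mulnC addKn modn2; case: (odd q). Qed.

Lemma eval_absent s Y (j : 'I_n) : reg s r_mask = mask Y -> reg s r_pow = 2 ^ j ->
  eval s absent = (j \notin Y).
Proof.
move=> sY sj; rewrite /= -/(reg s r_mask) -/(reg s r_pow) sY sj odd_complement.
by rewrite odd_mask.
Qed.

Lemma eval_target s Y (j : 'I_n) : reg s r_mask = mask Y -> reg s r_pow = 2 ^ j ->
  j \notin Y -> eval s target = mask (j |: Y).
Proof. by move=> sY sj jY; rewrite eval_op !eval_reg sY sj mask_setU1. Qed.

End Memory.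

Definition word_size (n : nat) : nat := (n * n + 2 * n).+1.

Lemma ltn_word n v k : v <= 2 ^ k -> k <= n * n + 2 * n -> v < 2 ^ word_size n.
Proof. by move=> v_le k_le; rewrite (leq_ltn_trans v_le) // ltn_exp2l. Qed.

Lemma ltn_word_small n v : v <= (n * n).+1 -> v < 2 ^ word_size n.
Proof.
move=> v_le; apply: (@ltn_word _ _ (n * n)); last exact: leq_addr.
by rewrite (leq_trans v_le) // ltn_expl.
Qed.

Lemma ltn_word_position n v : v <= n.+1 * 2 ^ n -> v < 2 ^ word_size n.
Proof.
move=> v_le; apply: (@ltn_word _ _ (n + n)); last by rewrite addnn mul2n leq_addl.
by rewrite (leq_trans v_le) // expnD leq_mul2r ltn_expl ?orbT.
Qed.

Lemma ltn_word_pow n v : v <= 2 ^ n -> v < 2 ^ word_size n.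
Proof. by move=> v_le; apply: ltn_word_position; rewrite (leq_trans v_le) // leq_pmull. Qed.

Lemma ltn_word_count n v : v <= 2 ^ (n * n) -> v < 2 ^ word_size n.
Proof. by move=> v_le; apply: ltn_word v_le _; rewrite leq_addr. Qed.

Section Correctness.

Variables (n : nat) (E : bigraph n) (W : nat).
Implicit Types (S X Y : {set 'I_n}) (F : {set 'I_n} -> nat) (s : state) (m : nat -> nat).

Local Notation run := (run (word_size n) W).
Local Notation get := (get n).
Local Notation put := (put n).

Lemma run_store a e1 e2 s (Q : state -> Prop) :
  reg s r_n = n -> eval s e2 < 2 ^ word_size n ->
  Q (upd s (inr (slot n a (eval s e1))) (eval s e2)) -> run (store a e1 e2) s 1 Q.
Proof.
by move=> sn lt_v Qs; apply: run_setmem; rewrite //= -/(reg s r_n) sn.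
Qed.

Lemma run_for_ord (I : nat -> state -> Prop) N r c s (Q : state -> Prop) :
  reg s r_n = n -> ~~ assigns c r -> ~~ assigns (For r ($r_n) c) r_n ->
  I 0 (upd s (inl r) 0) ->
  (forall (k : 'I_n) s', unchanged (For r ($r_n) c) s s' -> reg s' r = k -> I k s' ->
     run c s' N (fun s1 => I k.+1 (upd s1 (inl r) k.+1))) ->
  (forall s', unchanged (For r ($r_n) c) s s' -> I n s' -> Q s') ->
  run (For r ($r_n) c) s (for_steps n N) Q.
Proof.
move=> sn fresh_r fresh_n I0 run_c IQ; apply: (run_for (I := I)) => // [|s1 un|k s1 kn].
- by apply: ltn_word_small; nia.
- by rewrite eval_reg un.1.
- exact: run_c (Ordinal kn) s1.
Qed.

Lemma run_double_pow s k (Q : state -> Prop) :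
  k < n -> reg s r_pow = 2 ^ k -> Q (upd s (inl r_pow) (2 ^ k.+1)) ->
  run double_pow s 1 Q.
Proof.
move=> kn sk Qs; have powE : eval s (Cst 2 * $r_pow) = 2 ^ k.+1.
  by rewrite eval_op eval_reg sk expnS.
by apply: run_setreg; rewrite powE //; apply: ltn_word_pow; rewrite leq_exp2l.
Qed.

Lemma run_degree s (j : 'I_n) :
  reg s r_n = n -> encodes_graph E (memory s) -> reg s r_col = j ->
  run degree_cmd s (degree_steps n) (fun s' => reg s' r_degree = degree E (inr j)).
Proof.
move=> sn enc_s sj; apply: run_seq; apply: run_setreg; first exact: ltn_word_small.
pose f (i : 'I_n) : nat := (i, j) \in E.
apply: (run_for_ord (I := fun k s' => reg s' r_degree = prefix_sum f k)) => //.
- by rewrite !reg_upd prefix_sum0.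
- move=> i s1 un s1i Ii.
  have edgeE : eval s1 (current_edge) = f i.
    by apply: eval_current_edge; rewrite ?s1i // (un.1, un.2).
  have sumE : eval s1 ($r_degree + current_edge) = prefix_sum f i.+1.
    by rewrite eval_op edgeE eval_reg Ii prefix_sumS.
  apply: run_setreg => //; rewrite sumE ?reg_upd //.
  apply: ltn_word_small; rewrite (leq_trans (leq_prefix_sum _ _)) // -degree_inr.
  by have := degree_inr_le E j; nia.
- by move=> s1 _ ->; rewrite prefix_sum_full degree_inr.
Qed.

Lemma run_count s :
  reg s r_n = n -> encodes_graph E (memory s) -> reg s r_edges = 0 ->
  run count_cmd s (count_steps n) (fun s' => reg s' r_edges = #|E|).
Proof.
move=> sn enc_s s0; pose f (j : 'I_n) := degree E (inr j).
have sum_f : \sum_j f j = #|E|.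
  by rewrite (sum_degree_inr E predT); apply: eq_card => e; rewrite !inE andbT.
apply: (run_for_ord (I := fun k s' => reg s' r_edges = prefix_sum f k)) => //.
- by rewrite reg_upd prefix_sum0.
- move=> j s1 un s1j Ij.
  have deg_j : run degree_cmd s1 (degree_steps n) (fun s2 => reg s2 r_degree = f j).
    by apply: run_degree; rewrite ?s1j // (un.1, un.2).
  apply: (run_call deg_j) => s2 un2 s2j.
  have sumE : eval s2 ($r_edges + $r_degree) = prefix_sum f j.+1.
    by rewrite eval_op !eval_reg s2j un2.1 //= Ij prefix_sumS.
  apply: run_setreg; rewrite sumE ?reg_upd //.
  apply: ltn_word_small; rewrite (leq_trans (leq_prefix_sum _ _)) // sum_f.
  by rewrite (leq_trans (max_card _)) // card_prod card_ord leqnSn.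
- by move=> s1 _ ->; rewrite prefix_sum_full.
Qed.

Definition encodes_selection S m : Prop :=
  [/\ encodes_graph E m, forall j : 'I_n, get a_required m j = (j \in S)
    & forall i : 'I_n, get a_adjacent m i = \sum_(j in S) ((i, j) \in E)].

Definition blank m : Prop := get a_count m =1 (fun=> 0) /\ get a_queue m =1 (fun=> 0).

Lemma blank_put a x v m : a \in [:: a_required; a_adjacent] ->
  blank m -> blank (put a x v m).
Proof.
by rewrite !inE => /orP [] /eqP -> [blank_count blank_queue]; split=> y;
  rewrite get_put //= (blank_count, blank_queue).
Qed.

Lemma run_mark_neighbours s S (j : 'I_n) :
  reg s r_n = n -> encodes_graph E (memory s) -> blank (memory s) ->
  (forall i : 'I_n, get a_adjacent (memory s) i = \sum_(j' in S) ((i, j') \in E)) ->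
  reg s r_col = j -> j \notin S ->
  run mark_neighbours_cmd s (for_steps n 1) (fun s' =>
    [/\ encodes_graph E (memory s'), blank (memory s'),
        get a_required (memory s') =1 get a_required (memory s)
      & forall i : 'I_n,
          get a_adjacent (memory s') i = \sum_(j' in j |: S) ((i, j') \in E)]).
Proof.
move=> sn enc_s blank_s adj_s sj jS.
pose adj k (i : 'I_n) := \sum_(j' in S) ((i, j') \in E) + (i < k) * ((i, j) \in E).
apply: (run_for_ord (I := fun k s' => [/\ encodes_graph E (memory s'), blank (memory s'),
    get a_required (memory s') =1 get a_required (memory s)
  & forall i : 'I_n, get a_adjacent (memory s') i = adj k i])) => //.
- by split=> // i; rewrite memory_upd_reg adj_s /adj mul0n addn0.
- move=> i s1 un s1i [enc1 blank1 req1 adj1]; have s1n : reg s1 r_n = n by rewrite un.1.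
  have sumE : eval s1 (arr a_adjacent ($r_row) + current_edge) = adj i.+1 i.
    rewrite eval_op (eval_arr _ _ s1n) eval_reg s1i adj1 /adj ltnn ltnSn mul0n addn0.
    by rewrite (@eval_current_edge _ E _ i j) ?mul1n // un.1.
  apply: run_store => //; rewrite sumE.
    have adj_le : \sum_(j' in S) ((i, j') \in E) <= n.
      by rewrite -[leqRHS]card_ord leq_sum_bool.
    by apply: ltn_word_small; rewrite /adj ltnSn; have := leq_b1 ((i, j) \in E); nia.
  rewrite eval_reg s1i memory_upd_reg memory_store; split.
  + exact: encodes_graph_put.
  + exact: blank_put.
  + by move=> x; rewrite get_put //= req1.
  + move=> i'; rewrite get_put //= adj1 /adj (inj_eq val_inj).
    case: eqVneq => [->//|ne].
    by rewrite [i' < _.+1]ltnS (leq_eqVlt i') (inj_eq val_inj) (negbTE ne).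
- move=> s1 _ [enc1 blank1 req1 adj1]; split=> // i.
  by rewrite adj1 /adj ltn_ord mul1n big_setU1 //= addnC.
Qed.

Lemma run_choose s S (j : 'I_n) :
  reg s r_n = n -> encodes_selection S (memory s) -> blank (memory s) ->
  reg s r_col = j -> reg s r_chosen = #|S| -> j \notin S ->
  run choose_cmd s (choose_steps n)
    (fun s' => [/\ encodes_selection (j |: S) (memory s'), blank (memory s')
                 & reg s' r_chosen = #|j |: S|]).
Proof.
move=> sn [enc_s req_s adj_s] blank_s sj sc jS.
have cardU1 : #|j |: S| = #|S|.+1 by rewrite cardsU1 jS.
apply: run_seq; apply: run_store => //; first exact: ltn_word_small.
have mem_put : memory (upd s (inr (slot n a_required (eval s ($r_col)))) 1) =
    put a_required j 1 (memory s).
  by rewrite -sj.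
set s1 := upd _ _ _ in mem_put *.
have s1c : eval s1 ($r_chosen + Cst 1) = #|j |: S|.
  by rewrite eval_op eval_reg reg_upd_cell sc cardU1 /= addn1.
apply: run_seq; apply: run_setreg; rewrite s1c.
  by apply: ltn_word_small; rewrite (leq_trans (max_card _)) // card_ord; nia.
set s2 := upd _ _ _; have mem_s2 : memory s2 = put a_required j 1 (memory s) by [].
apply: (run_consequence (run_mark_neighbours (S := S) (j := j) _ _ _ _ _ _)) => //.
- by rewrite mem_s2; apply: encodes_graph_put.
- by rewrite mem_s2; apply: blank_put.
- by move=> i; rewrite mem_s2 get_put //= adj_s.
move=> s3 un [enc3 blank3 req3 adj3]; split=> //; last by rewrite un.1.
split=> // j'; rewrite req3 mem_s2 get_put //= in_setU1 (inj_eq val_inj) req_s.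
by case: eqVneq.
Qed.

Lemma run_select s :
  reg s r_n = n -> encodes_graph E (memory s) -> (forall a x, get a (memory s) x = 0) ->
  reg s r_edges = #|E| -> reg s r_chosen = 0 ->
  run select_cmd s (select_steps n) (fun s' => exists S,
    [/\ greedy E n S, encodes_selection S (memory s') & blank (memory s')]).
Proof.
move=> sn enc_s zero_s se sc.
apply: (run_for_ord (I := fun k s' => exists S,
  [/\ greedy E k S, encodes_selection S (memory s'), blank (memory s')
    & reg s' r_chosen = #|S|])) => //.
- exists set0; rewrite cards0; split=> //; first exact: greedy0.
    by split=> // x; rewrite zero_s ?inE ?big_set0.
  by split=> x; rewrite zero_s.
- move=> j s1 un s1j [S [greedyS ctx blank1 s1c]]; have [enc1 _ _] := ctx.
  have s1n : reg s1 r_n = n by rewrite un.1.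
  apply: (run_call (run_degree s1n enc1 s1j)) => s2 un2 s2j.
  have s2n : reg s2 r_n = n by rewrite un2.1.
  have s2e : reg s2 r_edges = #|E| by rewrite un2.1 // un.1.
  have s2c : reg s2 r_chosen = #|S| by rewrite un2.1.
  have mem2 : memory s2 = memory s1 by apply: un2.2.
  apply: run_if; rewrite eval_op muln_eq0 negb_or !eval_leq_test /= -!/(reg s2 _).
  rewrite s2n s2e s2c s2j addn1 -/(light E j) -/(affordable E _).
  case: ifPn => [/andP [light_j aff]|skip]; last first.
    apply: run_skip => //; exists S; rewrite memory_upd_reg mem2; split=> //.
    exact: greedy_skip.
  have jS : j \notin S.
    by case: greedyS => S_lt _ _; apply/negP => /S_lt; rewrite ltnn andbF.
  apply: (run_consequence (run_choose (S := S) (j := j) _ _ _ _ _ _)); rewrite ?mem2 //.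
    by rewrite un2.1.
  move=> s3 un3 [ctx3 blank3 s3c]; exists (j |: S); split=> //.
  exact: greedyU1.
- by move=> s1 _ [S [? ? ? _]]; exists S.
Qed.

Definition count_at m X : nat := get a_count m (mask X).

(* A layer only involves sets of one size, so that all layers can share one table. *)
Definition tabulates (i : nat) F m : Prop := forall X, i <= #|X| -> count_at m X = F X.

Definition holds_queue (lo : nat) (ls : seq {set 'I_n}) m : Prop :=
  forall x, x < size ls -> get a_queue m (lo + x) = mask (nth set0 ls x).

Definition queued F (lo hi : nat) m : Prop :=
  exists ls, [/\ enumerates ls F, holds_queue lo ls m & hi = lo + size ls].

Definition add_at F X c : {set 'I_n} -> nat := fun Y => F Y + (Y == X) * c.

Lemma count_at_put_count X Y v m :
  count_at (put a_count (mask Y) v m) X = if X == Y then v else count_at m X.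
Proof. by rewrite /count_at get_put //= (inj_eq (@mask_inj n)). Qed.

Lemma count_at_put_queue X x v m : count_at (put a_queue x v m) X = count_at m X.
Proof. by rewrite /count_at get_put. Qed.

Lemma tabulates_put_count i F X c m :
  tabulates i F m -> tabulates i (add_at F X c) (put a_count (mask X) (F X + c) m).
Proof.
move=> tabF Y iY; rewrite count_at_put_count /add_at.
by case: eqVneq => [->|_]; rewrite ?mul1n // mul0n addn0; apply: tabF.
Qed.

Lemma holds_queue_append lo ls X m : holds_queue lo ls m ->
  holds_queue lo (rcons ls X) (put a_queue (lo + size ls) (mask X) m).
Proof.
move=> hq x; rewrite size_rcons ltnS get_put //= eqn_add2l nth_rcons => x_le.
by case: ltngtP x_le => // ltx _; apply: hq.
Qed.

Lemma holds_queue_put lo ls x v m :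
  lo + size ls <= x -> holds_queue lo ls m -> holds_queue lo ls (put a_queue x v m).
Proof.
by move=> le_x hq y lty; rewrite get_put //= ltn_eqF ?hq // (leq_trans _ le_x) // ltn_add2l.
Qed.

Lemma queued_bounds F lo hi m : queued F lo hi m -> lo <= hi <= lo + 2 ^ n.
Proof.
move=> [ls [[uniq_ls _] _ ->]]; rewrite leq_addr leq_add2l.
by have := size_uniq_sets uniq_ls; rewrite card_ord.
Qed.

Lemma queued_append F X c lo hi m : queued F lo hi m -> F X = 0 -> c != 0 ->
  queued (add_at F X c) lo hi.+1 (put a_queue hi (mask X) m).
Proof.
move=> [ls [[uniq_ls memls] hq ->]] FX c_neq0; exists (rcons ls X).
have X_new : X \notin ls by rewrite memls inE FX.
split; [split=> [|Y]|exact: holds_queue_append|by rewrite size_rcons addnS].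
  by rewrite rcons_uniq X_new.
rewrite mem_rcons in_cons memls !inE /add_at addn_eq0 negb_and orbC.
by case: (Y == X); rewrite ?mul1n ?c_neq0 ?orbT.
Qed.

Lemma queued_add_at F X c lo hi m :
  queued F lo hi m -> F X != 0 -> queued (add_at F X c) lo hi m.
Proof.
move=> [ls [[uniq_ls memls] hq ->]] FX; exists ls; split=> //; split=> // Y.
rewrite memls !inE /add_at addn_eq0 negb_and.
by case: (eqVneq Y X) => [->|_]; rewrite ?FX // mul0n orbF.
Qed.

Lemma queued_put_count F x v lo hi m :
  queued F lo hi m -> queued F lo hi (put a_count x v m).
Proof.
move=> [ls [enum_ls hq ->]]; exists ls; split=> // y lty.
by rewrite get_put //= hq.
Qed.

Lemma encodes_selection_put S a x v m : a \in [:: a_count; a_queue] ->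
  encodes_selection S m -> encodes_selection S (put a x v m).
Proof.
by rewrite !inE => /orP [] /eqP -> [enc_m req_m adj_m]; split=> [|j|i];
  rewrite ?get_put //= ?req_m ?adj_m //; apply: encodes_graph_put.
Qed.

Lemma run_check s S Y :
  reg s r_n = n -> encodes_selection S (memory s) -> reg s r_mask = mask Y ->
  run check_cmd s (check_steps n) (fun s' => (reg s' r_missing != 0) = ~~ (S \subset Y)).
Proof.
move=> sn [_ req_s _] sY; pose f (j : 'I_n) : nat := (j \in S) && (j \notin Y).
apply: run_seq; apply: run_setreg; first exact: ltn_word_small.
apply: run_seq; apply: run_setreg; first exact: ltn_word_small.
apply: (run_for_ord
  (I := fun k s' => reg s' r_missing = prefix_sum f k /\ reg s' r_pow = 2 ^ k)) => //.
- by rewrite !reg_upd prefix_sum0.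
- move=> j s1 un s1j [s1m s1p]; have s1n : reg s1 r_n = n by rewrite un.1.
  have absentE : eval s1 absent = (j \notin Y) by apply: eval_absent; rewrite // un.1.
  have missE : eval s1 ($r_missing + arr a_required ($r_col) * absent) = prefix_sum f j.+1.
    rewrite 2!eval_op absentE (eval_arr _ _ s1n) !eval_reg s1j s1m un.2 //.
    by rewrite req_s /= mulnb prefix_sumS.
  apply: run_seq; apply: run_setreg; rewrite missE; last first.
    exact: (run_double_pow (ltn_ord j)).
  apply: ltn_word_small; rewrite (leq_trans (leq_prefix_sum _ _)) //.
  by rewrite (leq_trans (leq_sum_bool _ _)) // card_ord; nia.
- move=> s1 _ [-> _]; rewrite prefix_sum_full sum_nat_eq0 negb_forall.
  apply/existsP/subsetPn => [[j /=]|[j jS jY]]; last by exists j; rewrite /f jS jY.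
  by rewrite eqb0 negbK => /andP [jS jY]; exists j.
Qed.

Definition required (late : bool) S : {set 'I_n} := if late then S else set0.

Definition layer (i : nat) F s : Prop :=
  [/\ tabulates i F (memory s), queued F (reg s r_lo) (reg s r_end) (memory s)
    & reg s r_lo <= i * 2 ^ n].

Section Layer.

Variables (S : {set 'I_n}) (late : bool) (r : 'I_n) (i : nat).
Variables (F : {set 'I_n} -> nat) (ls : seq {set 'I_n}).
Implicit Types (P Q : {set 'I_n} -> nat) (j : 'I_n).

Hypothesis enum_ls : enumerates ls F.
Hypothesis card_F : forall X, F X != 0 -> #|X| = i.

(* P is the part of the next layer already in the table, and Q the part already
   in the queue. *)
Record expanding P Q s : Prop := Expanding {
  expanding_n : reg s r_n = n;
  expanding_row : reg s r_row = r;
  expanding_selection : encodes_selection S (memory s);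
  expanding_count : forall X, #|X| = i -> count_at (memory s) X = F X;
  expanding_queue : holds_queue (reg s r_lo) ls (memory s);
  expanding_hi : reg s r_hi = reg s r_lo + size ls;
  expanding_hi_le : reg s r_hi <= i.+1 * 2 ^ n;
  expanding_table : tabulates i.+1 P (memory s);
  expanding_next : queued Q (reg s r_hi) (reg s r_end) (memory s)
}.

Lemma expanding_agree P Q s s' :
  (forall x, x \in [:: r_n; r_row; r_lo; r_hi; r_end] -> reg s' x = reg s x) ->
  memory s' = memory s -> expanding P Q s -> expanding P Q s'.
Proof.
by move=> regE memE [*]; split; rewrite ?memE //; rewrite !regE.
Qed.

Lemma expanding_upd P Q s x v : x \notin [:: r_n; r_row; r_lo; r_hi; r_end] ->
  expanding P Q s -> expanding P Q (upd s (inl x) v).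
Proof.
move=> x_new; apply: expanding_agree => // y.
by rewrite reg_upd; case: eqP x_new => // -> /negP.
Qed.

Lemma queued_neq0 Y : Y \in ls -> F Y != 0.
Proof. by case: enum_ls => _ ->; rewrite inE. Qed.

Lemma queued_card Y : Y \in ls -> #|Y| = i.
Proof. by move=> /queued_neq0; apply: card_F. Qed.

Lemma run_enqueue P s Y j :
  expanding P P s -> Y \in ls -> j \notin Y ->
  reg s r_mask = mask Y -> reg s r_pow = 2 ^ j ->
  run enqueue_cmd s enqueue_steps (expanding P (add_at P (j |: Y) (F Y))).
Proof.
move=> ex Yls jY sY sj; have FY := queued_neq0 Yls.
have cardX : #|j |: Y| = i.+1 by rewrite cardsU1 jY queued_card.
have sn := expanding_n ex.
have targetE := eval_target sY sj jY.
have tableE : eval s (arr a_count target) = P (j |: Y).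
  by rewrite (eval_arr _ _ sn) targetE; apply: (expanding_table ex); rewrite cardX.
apply: run_if; rewrite tableE; case: ifPn => PX.
  apply: run_skip => //; case: ex => *; split=> //; exact: queued_add_at.
rewrite negbK in PX; apply: run_seq; apply: run_store => //.
  by rewrite targetE; apply/ltn_word_pow/ltnW/mask_lt.
rewrite targetE eval_reg; set s1 := upd _ _ _.
have mem1 : memory s1 = put a_queue (reg s r_end) (mask (j |: Y)) (memory s) by [].
have queue1 : queued (add_at P (j |: Y) (F Y)) (reg s r_hi) (reg s r_end).+1 (memory s1).
  by rewrite mem1; apply: queued_append (expanding_next ex) (eqP PX) FY.
have endE : eval s1 ($r_end + Cst 1) = (reg s r_end).+1.
  by rewrite eval_op eval_reg reg_upd_cell /= addn1.
apply: run_setreg; rewrite endE.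
  apply: ltn_word_position; have /andP [_ /leq_trans ->//] := queued_bounds queue1.
  rewrite (leq_trans (leq_add (expanding_hi_le ex) (leqnn _))) // addnC -mulSn.
  by rewrite leq_mul2r ltnS -cardX -[leqRHS]card_ord max_card orbT.
case: ex queue1 => _ row ctx count_ls queue_ls hiE hi_le table next queue1.
split=> //; rewrite memory_upd_reg mem1 //.
- exact: encodes_selection_put.
- by move=> X cardXi; rewrite count_at_put_queue count_ls.
- by apply: holds_queue_put => //; rewrite -hiE; case/andP: (queued_bounds next).
- by move=> X cardX_ge; rewrite count_at_put_queue table.
Qed.

Lemma run_push P s Y j :
  expanding P P s -> Y \in ls -> j \notin Y ->
  reg s r_mask = mask Y -> reg s r_pow = 2 ^ j -> P (j |: Y) + F Y <= 2 ^ (n * n) ->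
  run push_cmd s push_steps
    (expanding (add_at P (j |: Y) (F Y)) (add_at P (j |: Y) (F Y))).
Proof.
move=> ex Yls jY sY sj P_le.
have cardX : #|j |: Y| = i.+1 by rewrite cardsU1 jY queued_card.
apply: (run_call (run_enqueue ex Yls jY sY sj)) => s1 un1 ex1.
have s1n := expanding_n ex1.
have s1Y : reg s1 r_mask = mask Y by rewrite un1.1.
have targetE : eval s1 target = mask (j |: Y) by apply: eval_target; rewrite ?un1.1.
have sumE : eval s1 (arr a_count target + arr a_count ($r_mask)) = P (j |: Y) + F Y.
  rewrite eval_op !(eval_arr _ _ s1n) targetE eval_reg s1Y /=; congr (_ + _).
    by apply: (expanding_table ex1); rewrite cardX.
  exact: (expanding_count ex1 (queued_card Yls)).
apply: run_store => //; rewrite sumE; first exact: ltn_word_count.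
rewrite targetE; case: ex1 => _ row1 ctx1 count1 queue_ls hiE hi_le table1 next1.
split=> //; rewrite ?memory_store.
- exact: encodes_selection_put.
- move=> X cardXi; rewrite count_at_put_count ifN ?count1 //.
  by apply: contra_eq_neq cardXi => ->; rewrite cardX eq_sym ltn_eqF.
- by move=> x ltx; rewrite get_put //= queue_ls.
- exact: tabulates_put_count.
- exact: queued_put_count.
Qed.

Lemma run_extend P s Y j :
  expanding P P s -> Y \in ls -> reg s r_col = j ->
  reg s r_mask = mask Y -> reg s r_pow = 2 ^ j ->
  (forall X, P X + contrib E r F Y j X <= 2 ^ (n * n)) ->
  run extend_cmd s push_steps.+1
    (let P' X := P X + contrib E r F Y j X in expanding P' P').
Proof.
move=> ex Yls sj sY sp P_le /=; have sn := expanding_n ex.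
have [enc_s _ _] := expanding_selection ex.
have testE : (eval s (absent * current_edge) != 0) = (j \notin Y) && ((r, j) \in E).
  rewrite eval_op (eval_absent sY sp).
  by rewrite (eval_current_edge sn enc_s (expanding_row ex) sj) /= mulnb eqb0 negbK.
apply: run_if; rewrite testE; case: ifPn => [/andP [jY rj]|no_edge].
  have -> : (fun X => P X + contrib E r F Y j X) = add_at P (j |: Y) (F Y).
    by apply/funext => X; rewrite /contrib jY rj.
  apply: run_push => //; apply: leq_trans (P_le (j |: Y)).
  by rewrite /contrib jY rj eqxx mul1n.
have -> : (fun X => P X + contrib E r F Y j X) = P; last exact: run_skip.
by apply/funext => X; rewrite /contrib andbA (negbTE no_edge) addn0.
Qed.

Lemma run_expand P s Y :
  expanding P P s -> Y \in ls -> reg s r_mask = mask Y ->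
  (forall X, P X + \sum_j contrib E r F Y j X <= 2 ^ (n * n)) ->
  run expand_cmd s (expand_steps n)
    (let P' X := P X + \sum_j contrib E r F Y j X in expanding P' P').
Proof.
move=> ex Yls sY P_le /=; apply: run_seq; apply: run_setreg; first exact: ltn_word_small.
pose Pk k X := P X + prefix_sum (contrib E r F Y ^~ X) k.
apply: (run_for_ord
  (I := fun k s' => expanding (Pk k) (Pk k) s' /\ reg s' r_pow = 2 ^ k)) => //.
- exact: expanding_n ex.
- have -> : Pk 0 = P by apply/funext => X; rewrite /Pk prefix_sum0 addn0.
  by split=> //; do 2 apply: expanding_upd => //.
- move=> j s1 un s1j [ex1 s1p]; have s1Y : reg s1 r_mask = mask Y by rewrite un.1.
  have PkS X : Pk j X + contrib E r F Y j X = Pk j.+1 X by rewrite /Pk prefix_sumS addnA.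
  have Pk_le X : Pk j X + contrib E r F Y j X <= 2 ^ (n * n).
    by rewrite PkS (leq_trans _ (P_le X)) // leq_add2l leq_prefix_sum.
  apply: (run_call (run_extend ex1 Yls s1j s1Y s1p Pk_le)) => s2 un2 ex2.
  have s2p : reg s2 r_pow = 2 ^ j by rewrite un2.1.
  apply: run_double_pow s2p _ => //; split=> //; do 2 apply: expanding_upd => //.
  by rewrite -(funext PkS).
- move=> s1 _ [ex1 _]; have <- // : Pk n = fun X => P X + \sum_j contrib E r F Y j X.
  by apply/funext => X; rewrite /Pk prefix_sum_full.
Qed.

Lemma expanding_unchanged c P Q s s' :
  unchanged c s s' -> ~~ stores c ->
  all (fun x => ~~ assigns c x) [:: r_n; r_row; r_lo; r_hi; r_end] ->
  expanding P Q s -> expanding P Q s'.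
Proof.
move=> un no_store /allP fresh; apply: expanding_agree; last exact: un.2.
by move=> x /fresh; apply: un.1.
Qed.

Hypothesis next_le : forall X, next_layer E (required late S) r F X <= 2 ^ (n * n).

Definition visited k X : nat :=
  \sum_(Y <- take k ls | required late S \subset Y) \sum_j contrib E r F Y j X.

Lemma visitedS k X : k < size ls ->
  visited k.+1 X = visited k X +
    (required late S \subset nth set0 ls k) * \sum_j contrib E r F (nth set0 ls k) j X.
Proof.
move=> lt_k; rewrite /visited (take_nth set0 lt_k) -cats1 big_cat /= big_cons big_nil addn0.
by case: ifP; rewrite ?mul1n.
Qed.

Lemma visited_size X : visited (size ls) X = next_layer E (required late S) r F X.
Proof. by rewrite /visited take_size sum_enumerated. Qed.

Lemma run_expand_visited s k : k < size ls ->
  required late S \subset nth set0 ls k ->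
  expanding (visited k) (visited k) s -> reg s r_mask = mask (nth set0 ls k) ->
  run expand_cmd s (expand_steps n) (expanding (visited k.+1) (visited k.+1)).
Proof.
move=> lt_k req_Y ex sY.
have -> : visited k.+1 = fun X => visited k X + \sum_j contrib E r F (nth set0 ls k) j X.
  by apply/funext => X; rewrite visitedS // req_Y mul1n.
apply: run_expand => //; first exact: mem_nth.
move=> X; apply: leq_trans (next_le X).
have := sum_take_enumerated E (required late S) r k.+1 X enum_ls.
by rewrite -/(visited _ _) visitedS // req_Y mul1n.
Qed.

Lemma run_visit s k : k < size ls ->
  expanding (visited k) (visited k) s -> reg s r_pos = k ->
  run (visit_cmd late) s (visit_steps n) (expanding (visited k.+1) (visited k.+1)).
Proof.
move=> lt_k ex sk; set Y := nth set0 ls k; have sn := expanding_n ex.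
have maskE : eval s (arr a_queue ($r_lo + $r_pos)) = mask Y.
  by rewrite (eval_arr _ _ sn) eval_op !eval_reg sk; apply: (expanding_queue ex).
rewrite /visit_cmd; apply: run_seq; apply: run_setreg; rewrite maskE.
  exact/ltn_word_pow/ltnW/mask_lt.
set s1 := upd _ _ _; have s1Y : reg s1 r_mask = mask Y by [].
have {}ex : expanding (visited k) (visited k) s1 by apply: expanding_upd.
case: ifPn => late_eq; last first.
  apply: run_consequence (run_expand_visited lt_k _ ex s1Y) _ _ => //.
    by rewrite /required (negbTE late_eq) sub0set.
  by rewrite (leq_trans (leqnSn _)) ?leq_addl.
have check := run_check (expanding_n ex) (expanding_selection ex) s1Y.
apply: (run_call check) => s2 un2 s2Y.
have {}ex : expanding (visited k) (visited k) s2 by apply: expanding_unchanged un2 _ _ ex.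
apply: run_if; rewrite eval_reg s2Y; case: ifPn => [missing|]; last rewrite negbK => S_Y.
  apply: run_skip => //; have -> : visited k.+1 = visited k; last by [].
  by apply/funext => X; rewrite visitedS // /required late_eq (negbTE missing) addn0.
apply: run_expand_visited => //; first by rewrite /required late_eq.
by rewrite un2.1.
Qed.

Lemma run_layer s :
  reg s r_n = n -> reg s r_row = r -> encodes_selection S (memory s) -> i <= n ->
  tabulates i F (memory s) -> holds_queue (reg s r_lo) ls (memory s) ->
  reg s r_end = reg s r_lo + size ls -> reg s r_lo <= i * 2 ^ n ->
  run (layer_cmd late) s (layer_steps n (size ls)) (fun s' =>
    encodes_selection S (memory s') /\ layer i.+1 (next_layer E (required late S) r F) s').
Proof.
move=> sn sr ctx i_le tab queue_ls endE lo_le.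
have ls_le : size ls <= 2 ^ n.
  by case: enum_ls => uniq_ls _; have := size_uniq_sets uniq_ls; rewrite card_ord.
have end_le : reg s r_end <= i.+1 * 2 ^ n by rewrite endE mulSn addnC leq_add.
apply: run_seq; apply: run_setreg; rewrite eval_reg.
  by apply: ltn_word_position; rewrite (leq_trans end_le) // leq_mul2r ltnS i_le orbT.
have start : expanding (visited 0) (visited 0)
    (upd (upd s (inl r_hi) (reg s r_end)) (inl r_pos) 0).
  have visited0 X : visited 0 X = 0 by rewrite /visited take0 big_nil.
  split=> // [X cardX|X ltX|]; rewrite ?visited0; first by apply: tab; rewrite cardX.
    have [FX|] := eqVneq (F X) 0; first by rewrite -FX; apply/tab/ltnW.
    by move/card_F => cardX; rewrite cardX ltnn in ltX.
  by exists [::]; rewrite !reg_upd addn0; split=> //; split=> // X; rewrite inE visited0.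
apply: run_seq.
apply: (run_for (m := size ls) (I := fun k => expanding (visited k) (visited k))).
- exact: ltn_word_pow.
- by case: late.
- by move=> s1 un; rewrite eval_op !eval_reg !un.1 ?reg_upd /= ?endE ?addKn //; case: late.
- by [].
- move=> k s1 lt_k _ s1k ex1.
  apply: run_consequence (run_visit lt_k ex1 s1k) _ _ => // s2 _ ex2.
  exact: expanding_upd.
- move=> s1 _ ex1.
  have visitedE : visited (size ls) = next_layer E (required late S) r F.
    by apply/funext => X; rewrite visited_size.
  case: ex1; rewrite visitedE => _ _ ctx1 _ _ _ hi1_le table1 next1.
  apply: run_setreg; rewrite eval_reg //.
  rewrite (leq_ltn_trans hi1_le) //; apply: ltn_word_position.
  by rewrite leq_mul2r ltnS i_le orbT.
Qed.

End Layer.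

Section Passes.

Variables (S : {set 'I_n}) (B : nat).
Implicit Types (late : bool) (r : 'I_n).

Hypothesis binomial_le : forall k, k <= #|neighbours E S| -> 'C(n, k) <= B.
Hypothesis supersets_le : 2 ^ (n - #|S|) <= B.

Definition processed late (k : nat) : {set 'I_n} :=
  if late then neighbours E S :|: [set i : 'I_n | i < k]
  else [set i in neighbours E S | i < k].

Definition active late r : bool := (r \in neighbours E S) != late.

Lemma processedS late r :
  processed late r.+1 = if active late r then r |: processed late r else processed late r.
Proof.
apply/setP => i; have ltSr : (i < r.+1) = (i == r) || (i < r).
  by rewrite ltnS leq_eqVlt (inj_eq val_inj).
rewrite /active /processed; move: (neighbours E S) => A.
case: late; case: (boolP (r \in A)) => rA; rewrite !inE ltSr;
  by case: eqVneq => [->|] //=; rewrite ?rA ?(negbTE rA) ?orbT.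
Qed.

Lemma processed_fresh late r : active late r -> r \notin processed late r.
Proof.
rewrite /active /processed; move: (neighbours E S) => A.
by case: late; rewrite !inE ltnn ?andbF ?orbF //; case: (r \in A).
Qed.

Lemma processed_early_sub k : processed false k \subset neighbours E S.
Proof. by apply/subsetP => i; rewrite inE => /andP []. Qed.

Lemma processed_late0 : processed true 0 = processed false n.
Proof. by apply/setP => i; rewrite !inE ltn_ord orbF andbT. Qed.

Lemma processed_late_full : processed true n = setT.
Proof. by apply/setP => i; rewrite !inE ltn_ord orbT. Qed.

Lemma required_edge late r j :
  active late r -> j \in required late S -> (r, j) \notin E.
Proof.
rewrite /active /required; case: late => nbr_r jS; last by rewrite inE in jS.
apply: contraNN nbr_r => rj; rewrite eqb_id inE; apply/exists_inP; by exists j.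
Qed.

Lemma card_supp_next_layer late r F : active late r ->
  tracks E (required late S) (processed late r) F ->
  #|supp (next_layer E (required late S) r F)| <= B.
Proof.
move=> act trF; have rR := processed_fresh act.
case: late act trF rR => act trF rR.
  apply: leq_trans supersets_le; rewrite -[n in n - _]card_ord.
  by apply: card_superset_family => X; apply: supp_next_layer_superset.
have := tracks_next_layer rR (fun j => required_edge act) trF.
set R := r |: _ => trR; apply: leq_trans (binomial_le (k := #|R|) _).
  rewrite -[n in 'C(n, _)]card_ord; apply: card_uniform_family => X.
  by rewrite inE; apply: tracks_card trR.
apply/subset_leq_card; rewrite subUset processed_early_sub sub1set andbT.
by move: act; rewrite /active eqbF_neg negbK.
Qed.

Definition progress late (k : nat) s : Prop :=
  [/\ reg s r_n = n, encodes_selection S (memory s)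
    & exists F, [/\ tracks E (required late S) (processed late k) F, #|supp F| <= B
                  & layer #|processed late k| F s]].

Lemma layer_keeps_n late : ~~ assigns (layer_cmd late) r_n.
Proof. by case: late. Qed.

Lemma run_active_row late r s :
  active late r -> reg s r_row = r -> progress late r s ->
  run (layer_cmd late) s (layer_steps n B) (progress late r.+1).
Proof.
move=> act sr [sn ctx [F [trF supp_le [tab [ls [enum_ls queue_ls endE]] lo_le]]]].
have rR := processed_fresh act.
have next_tr := tracks_next_layer rR (fun j => required_edge act) trF.
have next_le X : next_layer E (required late S) r F X <= 2 ^ (n * n).
  by rewrite (leq_trans (next_tr.1 X)) ?card_matchings_le.
have R_le : #|processed late r| <= n by rewrite -[leqRHS]card_ord max_card.
apply: run_consequence (run_layer enum_ls (fun X => tracks_card trF) next_le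
  sn sr ctx R_le tab queue_ls endE lo_le) _ _.
  rewrite /layer_steps /for_steps !leq_add // !ltnS leq_mul2r.
  by rewrite (size_enumeration enum_ls) supp_le orbT.
move=> s1 un [ctx1 layer1]; split=> //; first by rewrite un.1 ?layer_keeps_n.
exists (next_layer E (required late S) r F).
rewrite processedS act cardsU1 rR; split=> //; exact: card_supp_next_layer.
Qed.

Lemma run_row late r s : reg s r_row = r -> progress late r s ->
  run (row_cmd late) s (layer_steps n B).+1 (progress late r.+1).
Proof.
move=> sr prog; have [sn [_ _ adj_s] [F [trF supp_le lay]]] := prog.
have adjE : (eval s (arr a_adjacent ($r_row)) != 0) = (r \in neighbours E S).
  rewrite (eval_arr _ _ sn) eval_reg sr adj_s sum_nat_eq0 negb_forall_in inE.
  by apply: eq_existsb => j; rewrite eqb0 negbK.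
apply: run_if; rewrite adjE.
suff run_active : run (if active late r then layer_cmd late else Skip)
    s (layer_steps n B) (progress late r.+1).
  by move: run_active; rewrite /active; case: (r \in _); case: (late).
case: ifPn => [|idle]; first by move/run_active_row; apply.
apply: run_skip => //; split; [by []|by case: prog|exists F].
by rewrite processedS (negbTE idle).
Qed.

Lemma run_pass late s : progress late 0 s ->
  run (pass_cmd late) s (pass_steps n B) (progress late n).
Proof.
move=> prog; have [sn _ _] := prog.
apply: (run_for_ord (I := progress late)) => //.
- by case: (late).
- by case: (late).
- move=> r s1 _ s1r prog1; exact: (run_consequence (run_row s1r prog1)).
Qed.

Lemma progress_late s : progress false n s -> progress true 0 s.
Proof.
move=> [sn ctx [F [trF supp_le lay]]]; split=> //; exists F; rewrite processed_late0.
by split=> //; apply: tracksW trF; apply: sub0set.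
Qed.

Lemma run_init s :
  reg s r_n = n -> reg s r_lo = 0 -> encodes_selection S (memory s) -> blank (memory s) ->
  run init_cmd s init_steps (progress false 0).
Proof.
move=> sn slo ctx [blank_count blank_queue]; have maskE := mask_set0 n.
apply: run_seq; apply: run_store => //; first exact: ltn_word_small.
set s1 := upd _ _ _.
have mem1 : memory s1 = put a_count (mask (set0 : {set 'I_n})) 1 (memory s).
  by rewrite maskE.
have lo1 : reg s1 r_lo = 0 by [].
apply: run_setreg; first exact: ltn_word_small.
have proc0 : processed false 0 = set0 by apply/setP => i; rewrite !inE andbF.
split=> //; first by rewrite memory_upd_reg mem1; apply: encodes_selection_put.
exists (fun X => X == set0); rewrite proc0 cards0; split; first exact: tracks_set0.
  have -> : supp (fun X : {set 'I_n} => X == set0) = [set set0].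
    by apply/setP => X; rewrite !inE eqb0 negbK.
  by rewrite cards1 -(bin0 n) binomial_le.
split; rewrite ?memory_upd_reg ?mem1 ?reg_upd ?lo1 //.
  by move=> X _; rewrite count_at_put_count /count_at blank_count; case: eqP.
exists [:: set0]; split=> //; first by split=> // X; rewrite !inE eqb0 negbK.
by case=> // _; rewrite get_put //= blank_queue maskE.
Qed.

Lemma run_output s : progress true n s ->
  run output_cmd s (output_steps n) (fun s' => output s' = #|perfect_matchings E|).
Proof.
move=> [sn _ [F [trF _ [tab _ _]]]].
rewrite processed_late_full in trF tab.
apply: run_seq; apply: run_setreg; first exact: ltn_word_small.
apply: run_seq; apply: (run_for_ord (I := fun k s' => reg s' r_pow = 2 ^ k)) => //.
- by move=> k s1 _ _ s1p; apply: run_double_pow s1p _.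
- move=> s1 un s1p; have s1n : reg s1 r_n = n by rewrite un.1.
  have resE : eval s1 (arr a_count ($r_pow - Cst 1)) = #|perfect_matchings E|.
    rewrite (eval_arr _ _ s1n) eval_op eval_reg s1p /= -mask_setT un.2 //.
    by rewrite -(tracks_setT trF); apply: tab; rewrite cardsT.
  apply: run_setreg; rewrite resE //.
  by apply: ltn_word_count; rewrite -matchings_setT card_matchings_le.
Qed.

End Passes.

Lemma run_matching_count B :
  (forall S, greedy E n S ->
     (forall k, k <= #|neighbours E S| -> 'C(n, k) <= B) /\ 2 ^ (n - #|S|) <= B) ->
  run matching_count_cmd (input E) (matching_count_steps n B)
    (fun s' => output s' = #|perfect_matchings E|).
Proof.
move=> B_ge; rewrite /matching_count_cmd /matching_count_steps; set s := input E.
have sn : reg s r_n = n by [].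
have count_edges := run_count sn (encodes_graph_input E) (erefl 0 : reg s r_edges = 0).
apply: (run_call count_edges) => s1 un1 s1e.
have mem1 : memory s1 = memory s by apply: un1.2.
have select : run select_cmd s1 (select_steps n) (fun s' => exists S,
    [/\ greedy E n S, encodes_selection S (memory s') & blank (memory s')]).
  apply: run_select => //; rewrite ?un1.1 // mem1; first exact: encodes_graph_input.
  exact: get_input.
apply: (run_call select) => s2 un2 [S [greedyS ctx2 blank2]].
have [bin_le sup_le] := B_ge S greedyS.
have init : run init_cmd s2 init_steps (progress S B false 0).
  by apply: run_init; rewrite ?un2.1 ?un1.1.
apply: (run_call init) => s3 _ early0.
apply: (run_call (run_pass bin_le sup_le early0)) => s4 _ early.
apply: (run_call (run_pass bin_le sup_le (progress_late early))) => s5 _.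
exact: run_output.
Qed.

End Correctness.

(** * Running time *)

Lemma mul_binomial_le_exp3 n k : 'C(n, k) * 2 ^ (n - k) <= 3 ^ n.
Proof.
have [k_le|/bin_small -> //] := leqP k n.
rewrite -[3]/(2 + 1) expnDn (bigD1 (Ordinal (k_le : k < n.+1))) //=.
by rewrite exp1n muln1 leq_addr.
Qed.

Lemma binomial_le_exp2 n k : 'C(n, k) <= 2 ^ n.
Proof.
have [k_le|/bin_small -> //] := leqP k n.
rewrite -[2]/(1 + 1) expnDn (bigD1 (Ordinal (k_le : k < n.+1))) //=.
by rewrite !exp1n !muln1 leq_addr.
Qed.

Definition max_binomial (n : nat) : nat := \max_(k < n.+1 | 10 * k <= 3 * n) 'C(n, k).

(* From C(n, k) <= 3^n / 2^(n - k) and 3^5 <= 2^8. *)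
Lemma max_binomial_exp10_le n : max_binomial n ^ 10 <= 2 ^ (9 * n).
Proof.
rewrite /max_binomial; elim/big_ind: _ => [|a b le_a le_b|k le_k]; first by rewrite exp0n.
  by rewrite /maxn; case: ifP.
have exp3 : 3 ^ (10 * n) <= 2 ^ (16 * n).
  rewrite -[10]/(5 * 2) -[16]/(8 * 2) -!mulnA !(expnM _ _ (2 * n)).
  by case: (2 * n) => // m; rewrite leq_exp2r.
rewrite -(@leq_pmul2r (2 ^ (7 * n))) ?expn_gt0 // -expnD -mulnDl.
apply: leq_trans exp3; rewrite [10 * n]mulnC (expnM 3).
rewrite (@leq_trans (('C(n, k) * 2 ^ (n - k)) ^ 10)) ?leq_exp2r ?mul_binomial_le_exp3 //.
by rewrite expnMn leq_mul // -expnM leq_exp2l //; lia.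
Qed.

Definition layer_bound n (E : bigraph n) : nat :=
  2 ^ (n - (n * n) %/ (5 * #|E|)) + max_binomial n.

Lemma greedy_layer_bound n (E : bigraph n) (S : {set 'I_n}) :
  0 < n -> 3 * n <= #|E| -> greedy E n S ->
  (forall k, k <= #|neighbours E S| -> 'C(n, k) <= layer_bound E) /\
  2 ^ (n - #|S|) <= layer_bound E.
Proof.
move=> n_gt0 leE greedyS; have [S_light S_aff _] := greedyS.
have light_S j : j \in S -> light E j by case/S_light/andP.
have nbr_le := card_light_neighbours_le n_gt0 light_S S_aff.
split=> [k k_le|].
  have ltk : k < n.+1.
    by rewrite ltnS (leq_trans k_le) // -[leqRHS]card_ord max_card.
  apply: leq_trans (leq_addl _ _); apply: (leq_bigmax_cond (Ordinal ltk)) => /=.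
  by rewrite (leq_trans _ nbr_le) // leq_mul2l k_le orbT.
apply: leq_trans (leq_addr _ _); rewrite leq_exp2l // leq_sub2l //.
have := greedy_not_affordable n_gt0 leE greedyS; rewrite /affordable -ltnNge => S_max.
by rewrite -ltnS ltn_divLR 1?mulnC //; lia.
Qed.

Lemma layer_bound_le_exp2 n (E : bigraph n) : layer_bound E <= 2 ^ n.+1.
Proof.
rewrite expnS mul2n -addnn leq_add ?leq_exp2l ?leq_subr //.
by apply/bigmax_leqP => k _; apply: binomial_le_exp2.
Qed.

Lemma bounded_input n (E : bigraph n) : bounded (word_size n) (input E).
Proof.
move=> l; rewrite bitlen_leE //; apply: ltn_word_small.
case: l => [r|a] /=; last by case: [exists i, _].
by case: eqP => // _; nia.
Qed.

Lemma matching_count_time : exists K : nat, forall n (E : bigraph n),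
  0 < n -> 3 * n <= #|E| ->
  exists s t tr, [/\ exec matching_count_cmd (input E) s t tr,
    output s = #|perfect_matchings E| & t <= K * n.+1 ^ 6 * layer_bound E].
Proof.
set W := max_step_size matching_count_cmd.
exists (200 * (4 * W ^ 2)) => n E n_gt0 leE.
have bound_ge S := @greedy_layer_bound n E S n_gt0 leE.
have [s [t [tr [ex le_t _ out]]]] :=
  run_matching_count bound_ge (bounded_input E) (leqnn W).
exists s, t, tr; split=> //; apply: leq_trans le_t _.
have B_gt0 : 0 < layer_bound E by rewrite /layer_bound addn_gt0 expn_gt0.
have word_le : word_size n ^ 2 <= 4 * n.+1 ^ 4.
  by rewrite -[4 * _]/(2 ^ 2 * _) (expnM _ 2 2) -expnMn leq_exp2r // /word_size -mulnn; nia.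
have steps_le := matching_count_steps_le n B_gt0.
rewrite expnMn (leq_trans (leq_mul steps_le (leq_mul (leqnn _) word_le))) //.
rewrite -[6]/(2 + 4) expnD.
by move: (n.+1 ^ 2) (n.+1 ^ 4) (W ^ 2) (layer_bound E) => a b w B; nia.
Qed.

Import Order.TTheory GRing.Theory Num.Theory.
Local Open Scope ring_scope.

Lemma avg_degreeE (R : realType) n (E : bigraph n) :
  avg_degree R E = #|E|%:R / n%:R.
Proof.
rewrite /avg_degree card_sum card_ord addnn -muln2 natrM [2 * _]mulrC -mulf_div.
by rewrite divff ?mulr1 // pnatr_eq0.
Qed.

Lemma avg_degree_ge3 (R : realType) n (E : bigraph n) :
  3 <= avg_degree R E -> (0 < n)%N /\ (3 * n <= #|E|)%N.
Proof.
rewrite avg_degreeE => D_ge3; suff n_gt0 : (0 < n)%N.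
  by split=> //; rewrite -(ler_nat R) natrM -ler_pdivlMr ?ltr0n.
rewrite lt0n; apply: contraTneq D_ge3 => n0; have -> : n%:R = 0 :> R by rewrite n0.
by rewrite -ltNge invr0 mulr0 ltr0n.
Qed.

Lemma log2_ge1 (R : realType) (x : R) : 2 <= x -> 1 <= log2 x.
Proof.
move=> x_ge2; have ln2_gt0 : 0 < ln (2 : R) by apply: ln_gt0; lra.
by rewrite /log2 ler_pdivlMr // mul1r ler_ln // posrE; lra.
Qed.

Lemma inv_mul_log2_le (R : realType) (x : R) : 2 <= x ->
  1 / (5 * x * log2 x) <= 1 / (5 * x).
Proof.
move=> x_ge2; have log_ge1 := log2_ge1 x_ge2.
by rewrite !div1r lef_pV2 ?posrE; nra.
Qed.

Lemma exp2_sub_divn_le_powR (R : realType) (n : nat) (Delta y : R) (edges : nat) :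
  (0 < n)%N -> 1 <= Delta -> edges%:R = Delta * n%:R -> y <= 1 / (5 * Delta) ->
  (2 ^ (n - (n * n) %/ (5 * edges)))%:R <= 2 * 2 `^ ((1 - y) * n%:R) :> R.
Proof.
move=> n_gt0 D_ge1 edgesE y_le; set k := (_ %/ _)%N.
have nR : 0 < n%:R :> R by rewrite ltr0n.
have edges_gt0 : (0 < edges)%N by rewrite -(ltr0n R) edgesE; nra.
have k_ge : n%:R / (5 * Delta) <= k%:R + 1.
  have : (n * n)%:R <= (k.+1 * (5 * edges))%:R :> R.
    by rewrite ler_nat ltnW // -ltn_divLR ?muln_gt0.
  rewrite natr1 ler_pdivrMr; last by lra.
  by rewrite !natrM edgesE; nra.
have k_le : (k <= n)%N.
  have : (k * (5 * edges) <= n * n)%N by apply: leq_divM.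
  have : (n <= edges)%N by rewrite -(ler_nat R) edgesE; nra.
  nia.
have -> : 2 * 2 `^ ((1 - y) * n%:R) = 2 `^ (1 + (1 - y) * n%:R) :> R.
  by rewrite powRD ?powRr1 // pnatr_eq0 implybT.
rewrite natrX -powR_mulrn // natrB //; apply: ler_powR; first by lra.
have := ler_wpM2r (ltW nR) y_le; rewrite mul1r mulrC in k_ge *.
by rewrite mulrBl mul1r; move: (y * n%:R) (_^-1 * n%:R) k_ge => a b; lra.
Qed.

Lemma max_binomial_le_powR (R : realType) (n : nat) (y : R) : y <= 1 / 10 ->
  (max_binomial n)%:R <= 2 `^ ((1 - y) * n%:R).
Proof.
move=> y_le; apply: (@le_trans _ _ (2 `^ (9 / 10 * n%:R))); last first.
  by apply: ler_powR; [lra | apply: ler_wpM2r; [rewrite ler0n | lra]].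
rewrite -(@ler_pXn2r _ 10) ?nnegrE ?powR_ge0 ?ler0n //.
rewrite -natrX -[leRHS]powR_mulrn ?powR_ge0 // -powRrM.
have -> : 9 / 10 * n%:R * 10 = (9 * n)%:R :> R by rewrite natrM; field.
by rewrite powR_mulrn // -natrX ler_nat max_binomial_exp10_le.
Qed.

Lemma layer_bound_le_powR (R : realType) n (E : bigraph n) :
  let Delta := avg_degree R E in
  (0 < n)%N -> 3 <= Delta ->
  (layer_bound E)%:R <= 3 * 2 `^ ((1 - 1 / (5 * Delta * log2 Delta)) * n%:R).
Proof.
move=> Delta n_gt0 D_ge3; have D_ge2 : 2 <= Delta by lra.
have := inv_mul_log2_le D_ge2; set y := 1 / (_ * log2 _) => y_le.
have edgesE : #|E|%:R = Delta * n%:R :> R.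
  by rewrite /Delta avg_degreeE divfK // pnatr_eq0 -lt0n.
have tenth : 1 / (5 * Delta) <= 1 / 10 by rewrite !div1r lef_pV2 ?posrE; lra.
rewrite /layer_bound natrD -[3]/(2 + 1)%:R natrD mulrDl mul1r lerD //.
  by apply: exp2_sub_divn_le_powR edgesE y_le => //; lra.
exact/max_binomial_le_powR/(le_trans y_le).
Qed.

Lemma mul_expn_le_exp2 (K n b : nat) : (0 < n)%N -> (b <= 2 ^ n.+1)%N ->
  (K * n.+1 ^ 6 * b <= 2 ^ ((K + 8) * n))%N.
Proof.
move=> n_gt0 b_le.
have K_le : (K <= 2 ^ (K * n))%N.
  by rewrite (leq_trans (ltnW (ltn_expl _ (isT : 1 < 2)%N))) // leq_exp2l // leq_pmulr.
have n_le : (n.+1 ^ 6 <= 2 ^ (6 * n))%N by rewrite mulnC expnM leq_exp2r // ltn_expl.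
rewrite (leq_trans (leq_mul (leq_mul K_le n_le) b_le)) // -!expnD leq_exp2l //; nia.
Qed.

Theorem theorem3 (R : realType) :
  exists (p : cmd) (q : {poly R}) (c : nat),
    forall (n : nat) (E : bigraph n),
      let Delta := avg_degree R E in
      3 <= Delta ->
      exists (s : state) (t : nat) (tr : trace),
        [/\ exec p (input E) s t tr,
            output s = #|perfect_matchings E|,
            t%:R <= q.[n%:R]
                    * 2 `^ ((1 - 1 / (5 * Delta * log2 Delta)) * n%:R)
          & (ram_space tr <= 2 ^ (c * n))%N].
Proof.
have [K time_le] := matching_count_time.
exists matching_count_cmd, ((3 * K)%:R *: ('X + 1) ^+ 6), (K + 8)%N => n E Delta D_ge3.
have [n_gt0 edges_ge] := avg_degree_ge3 D_ge3.
have [s [t [tr [ex out t_le]]]] := time_le n E n_gt0 edges_ge.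
exists s, t, tr; split=> //.
  have bound_le := layer_bound_le_powR n_gt0 D_ge3; rewrite -/Delta in bound_le.
  rewrite hornerZ horner_exp hornerD hornerX hornerC natr1 -natrX.
  apply: le_trans (_ : (K * n.+1 ^ 6)%:R * (layer_bound E)%:R <= _).
    by rewrite -natrM ler_nat.
  apply: le_trans (ler_wpM2l (ler0n _ _) bound_le) _.
  by rewrite !natrM le_eqVlt; apply/orP; left; apply/eqP; ring.
apply: leq_trans (ram_space_le_time ex) (leq_trans t_le _).
exact: mul_expn_le_exp2 (layer_bound_le_exp2 E).
Qed.
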